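(* Let $m$ be fixed, let $\boldsymbol U=(U_1,\dots,U_m)$ have exact uniform$(0,1)$ margins, let $\boldsymbol w$ be a fixed weight vector with $w_i>0$ and $\sum_iw_i=1$, and put $Y_i=U_i^{-1}$. For every $I\subseteq[m]$ with $|I|\ge2$, suppose the marginal copula of $\boldsymbol U_I=(U_i)_{i\in I}$ has a density $c_I$. Assume that, for some $u_0\in(0,1)$ and constants $M_I<\infty$, $$\operatorname*{ess\,sup}_{\boldsymbol u_I\in(0,1)^I,\ \min_{i\in I}u_i\le u_0}c_I(\boldsymbol u_I)\le M_I .$$ For each pair $i<j$, assume that the finite lower-corner limit $$\lambda_{ij}=\lim_{s\downarrow0}\operatorname*{ess\,sup}_{0<u,v\le s}c_{ij}(u,v)=\lim_{s\downarrow0}\operatorname*{ess\,inf}_{0<u,v\le s}c_{ij}(u,v)$$ exists. Define $L^{(0)}_{\boldsymbol w}=\sum_{i<j}\lambda_{ij}w_iw_j$. Then, as $t\to\infty$, $$\Pr\!\left(\sum_{i=1}^mw_iY_i>t\right)=\frac1t+2L^{(0)}_{\boldsymbol w}\frac{\log t}{t^2}+o\!\left(\frac{\log t}{t^2}\right).$$ More precisely, let $\omega_{ij}(s)=\operatorname*{ess\,sup}_{0<u,v\le s}|c_{ij}(u,v)-\lambda_{ij}|$. If $$\int_0^{u_0}\frac{\omega_{ij}(s)}{s}\,ds<\infty\qquad\text{for all } i<j, \tag{D}$$ then $$\Pr\!\left(\sum_{i=1}^mw_iY_i>t\right)=\frac1t+2L^{(0)}_{\boldsymbol w}\frac{\log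 t}{t^2}+O(t^{-2}).$$ Condition (D) holds, in particular, if $c_{ij}(u,v)-\lambda_{ij}=O\{(u+v)^\eta\}$ as $(u,v)\to(0,0)$ for some $\eta>0$ and all $i<j$. Let $H_i=\cot(\pi U_i/2)$ and $c=2/\pi$. Assuming only that $\boldsymbol U$ has exact uniform$(0,1)$ margins, that $w_i>0$ with $\sum_iw_i=1$, that for every $I\subseteq[m]$ with $|I|\ge2$ the density $c_I$ exists and has essential supremum at most $M_I<\infty$ over $\{\boldsymbol u_I\in(0,1)^I:\min_{i\in I}u_i\le u_0\}$, and that the finite lower-corner limit $\lambda_{ij}$ exists for every pair $i<j$ (without assuming (D)), one has, as $t\to\infty$, $$\Pr\!\left(\sum_{i=1}^mw_iH_i>t\right)=\frac ct+2c^2L^{(0)}_{\boldsymbol w}\frac{\log t}{t^2}+o\!\left(\frac{\log t}{t^2}\right),$$ and the final remainder is $O(t^{-2})$ if in addition (D) holds.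
   Context: $[m]=\{1,\dots,m\}$; $c_{ij}=c_{\{i,j\}}$ is the density of the bivariate marginal copula of $(U_i,U_j)$. Essential suprema and infima are with respect to Lebesgue measure. *)

(* Defs.v *)
From HB Require Import structures.
From mathcomp Require Import all_boot all_order all_algebra.
From mathcomp Require Import all_classical all_reals all_analysis.
From mathcomp Require Import ess_sup_inf.

Set Implicit Arguments.
Unset Strict Implicit.
Unset Printing Implicit Defensive.

Import Order.TTheory GRing.Theory Num.Theory.
Import numFieldNormedType.Exports.

Local Open Scope classical_set_scope.
Local Open Scope ring_scope.

(* The Landau notations need a canonical [filter_on], which is missing for +oo. *)
Canonical pinfty_nbhs_filter_on (R : numFieldType) :=
  FilterType (pinfty_nbhs R) _.

(* Lebesgue measure on [n.-tuple R], by recursion on n: the image of the product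
   of the Lebesgue measures on R and on R^n under (x, t) |-> x :: t. *)
Section lebesgue_cons.
Context (R : realType) (n : nat).
Local Notation RT := (measurableTypeR R).
Variable mu : {sigma_finite_measure set (n.-tuple RT) -> \bar R}.

Definition tuple_cons (p : RT * n.-tuple RT) : n.+1.-tuple RT :=
  [tuple of p.1 :: p.2].

Let measurable_tuple_cons : measurable_fun [set: RT * n.-tuple RT] tuple_cons.
Proof. exact: measurable_cons. Qed.

Definition lebesgue_cons : set (n.+1.-tuple RT) -> \bar R :=
  pushforward (lebesgue_measure \x mu)%E tuple_cons.

Let lebesgue_cons0 : lebesgue_cons set0 = 0%E.
Proof. by rewrite /lebesgue_cons /pushforward preimage_set0 measure0. Qed.

Let lebesgue_cons_ge0 A : (0 <= lebesgue_cons A)%E.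
Proof. exact: measure_ge0. Qed.

Let lebesgue_cons_sigma_additive : semi_sigma_additive lebesgue_cons.
Proof. rewrite /lebesgue_cons; exact: measure_semi_sigma_additive. Qed.

HB.instance Definition _ := isMeasure.Build _ _ _ lebesgue_cons
  lebesgue_cons0 lebesgue_cons_ge0 lebesgue_cons_sigma_additive.

Let lebesgue_cons_sigma_finite : sigma_finite setT lebesgue_cons.
Proof.
have /sigma_finiteP[F [FT ndF Foo]] := sigma_finiteT (@lebesgue_measure R).
have /sigma_finiteP[G [GT ndG Goo]] := sigma_finiteT mu.
pose g (t : n.+1.-tuple RT) : RT * n.-tuple RT := (thead t, [tuple of behead t]).
have mg : measurable_fun [set: n.+1.-tuple RT] g.
  apply/measurable_fun_pairP; split; first exact: measurable_tnth.
  exact: measurable_behead.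
exists (fun i => g @^-1` (F i `*` G i)).
  rewrite -preimage_bigcup (_ : \bigcup_i _ = setT) ?preimage_setT//.
  rewrite -subTset => -[x y] _.
  have [k _ Fkx] : (\bigcup_i F i) x by rewrite -FT.
  have [l _ Gly] : (\bigcup_i G i) y by rewrite -GT.
  exists (maxn k l) => //; split.
  - by move: x Fkx; exact/subsetPset/ndF/leq_maxl.
  - by move: y Gly; exact/subsetPset/ndG/leq_maxr.
move=> i; have [mFi Fioo] := Foo i; have [mGi Gioo] := Goo i; split.
  by rewrite -[X in measurable X]setTI; apply: mg => //; exact: measurableX.
rewrite /lebesgue_cons /pushforward -comp_preimage.
rewrite (_ : g \o _ = id); last first.
  by apply/funext => -[x t]; congr pair; exact/val_inj.
rewrite preimage_id product_measure1E// lte_mul_pinfty// ge0_fin_numE//.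
Qed.

HB.instance Definition _ := Measure_isSigmaFinite.Build _ _ _ lebesgue_cons
  lebesgue_cons_sigma_finite.

End lebesgue_cons.

Fixpoint lebesgue_tuple (R : realType) (n : nat) :
    {sigma_finite_measure set (n.-tuple (measurableTypeR R)) -> \bar R} :=
  match n with
  | 0%N => \d_ [tuple]
  | n'.+1 => lebesgue_cons (lebesgue_tuple R n')
  end.

Lemma lebesgue_tuple_box (R : realType) (n : nat)
    (A : 'I_n -> set (measurableTypeR R)) :
  (forall i, measurable (A i)) ->
  lebesgue_tuple R n [set t | forall i, A i (tnth t i)] =
  (\prod_(i < n) lebesgue_measure (A i))%E.
Proof.
elim: n A => [|n IH] A mA /=.
  by rewrite big_ord0 diracE (_ : _ \in _ = true)//; apply/mem_set => -[].
rewrite big_ord_recl /lebesgue_cons /pushforward -IH//.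
have mbox : measurable [set t : n.-tuple (measurableTypeR R) |
    forall i, A (lift ord0 i) (tnth t i)].
  rewrite (_ : mkset _ = \bigcap_(i in [set: 'I_n])
      ((fun t => tnth t i) @^-1` (A (lift ord0 i)))).
    apply: fin_bigcap_measurable => // i _; rewrite -[X in measurable X]setTI.
    exact: measurable_tnth.
  by apply/seteqP; split => [t h i _|t h i]; exact: h.
rewrite -product_measure1E//; congr (_ _); apply/seteqP; split => -[x t] /=.
- move=> h; split; first exact: (h ord0).
  by move=> i; have := h (lift ord0 i); rewrite tnthS.
- by move=> -[/= Ax At] i; case: (unliftP ord0 i) => [j ->|->//]; rewrite tnthS.
Qed.

Section copula.
Context (R : realType).
Local Notation RT := (measurableTypeR R).

(* Essential supremum (resp. infimum) over A: outside A the function is set to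
   -oo (resp. +oo), so that only the points of A matter. *)
Definition ess_sup_on d (T : measurableType d) (mu : {measure set T -> \bar R})
    (A : set T) (f : T -> R) : \bar R :=
  ess_sup mu (patch (cst -oo%E) A (EFin \o f)).

Definition ess_inf_on d (T : measurableType d) (mu : {measure set T -> \bar R})
    (A : set T) (f : T -> R) : \bar R :=
  ess_inf mu (patch (cst +oo%E) A (EFin \o f)).

Definition open_cube (n : nat) : set (n.-tuple RT) :=
  [set u | forall k, 0 < tnth u k < 1].

Definition subvector (T : Type) (m : nat) (U : 'I_m -> T -> R)
    (I : {set 'I_m}) (x : T) : #|I|.-tuple RT :=
  [tuple U (enum_val k) x | k < #|I|].

(* f is a density of the law of (U_i)_(i in I) on the open unit cube; the values
   of f outside the cube are irrelevant. The indices of I are listed by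
   [enum_val]. *)
Definition is_marginal_density d (T : measurableType d) (P : probability T R)
    (m : nat) (U : 'I_m -> T -> R) (I : {set 'I_m})
    (f : #|I|.-tuple RT -> R) : Prop :=
  [/\ measurable_fun (@open_cube #|I|) f,
      forall u, @open_cube #|I| u -> 0 <= f u &
      forall A, measurable A ->
        P (subvector U I @^-1` A) =
        (\int[lebesgue_tuple R #|I|]_(u in A `&` @open_cube #|I|) (f u)%:E)%E].

(* The unit 1 of the iterated minimum is harmless: the coordinates are < 1. *)
Definition lower_boundary (n : nat) (u0 : R) : set (n.-tuple RT) :=
  [set u | open_cube u /\ \big[Num.min/1]_(k < n) tnth u k <= u0].

(* c_ij (u, v) := c_{i,j} evaluated at the tuple whose coordinate of index i is u
   and whose coordinate of index j is v, whatever the enumeration of {i, j}. *)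
Definition pair_density (m : nat) (c : forall I : {set 'I_m}, #|I|.-tuple RT -> R)
    (i j : 'I_m) (p : RT * RT) : R :=
  c [set i; j]%SET
    [tuple if enum_val k == i then p.1 else p.2 | k < #|[set i; j]%SET|].

Definition corner (s : R) : set (RT * RT) :=
  [set p | 0 < p.1 <= s /\ 0 < p.2 <= s].

Definition omega (f : RT * RT -> R) (lam s : R) : \bar R :=
  ess_sup_on (lebesgue_measure \x lebesgue_measure)%E (corner s)
    (fun p => `|f p - lam|).

Definition cot (x : R) : R := cos x / sin x.

End copula.

(* Main.v *)
Require Import Defs.
From HB Require Import structures.
From mathcomp Require Import all_boot all_order all_algebra.
From mathcomp Require Import all_classical all_reals all_analysis.
From mathcomp Require Import ess_sup_inf measurable_realfun.
From mathcomp Require Import ring lra.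

(* Put V_i = w_i / U_i. Up to events of probability O(t^-2), on which two of the V_i
   are of order t, the sum exceeds t because one V_i exceeds t, or because V_i lies in
   a bin ]t - n - 1, t - n] with n <= t / 2 and the other V_j add up to more than n.
   The bin has probability about w_i / t^2. Inside it, the event that the others exceed
   n is squeezed between {some V_j > n + 1} and {some V_j > n - sqrt n, or V_j > n / m
   and V_k > sqrt n / m}. Hence only probabilities of two- and three-dimensional boxes
   are needed: the triples cost O(n^(-3/2) t^-2), and a pair costs
   lambda_ij w_i w_j / (n t^2), up to omega_ij(2 / n) / (n t^2). Summing over n, the
   main terms form a harmonic sum of order log t, the triples converge, and the sum of
   omega_ij(2 / n) / n is o(log t), and bounded under (D). For the cotangents,
   1 / x - x <= cot x <= 1 / x squeezes the tail at t between the tails of the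
   reciprocals at pi t / 2 and at pi (t + pi / 2) / 2, which differ by O(t^-2). *)

Set Implicit Arguments.
Unset Strict Implicit.
Unset Printing Implicit Defensive.

Import Order.TTheory GRing.Theory Num.Theory.
Import numFieldNormedType.Exports.
Local Open Scope classical_set_scope.
Local Open Scope ring_scope.

(** A remainder O(t^-2) requires errors that are summable over the bins, and this shapes the
    decomposition. Lowering the threshold n by n^p changes 1 / n by about n^(p-2), while a second
    competitor of size n^p costs n^(-1-p); both series converge for 0 < p < 1, and sqrt n balances
    them. For the same reason the bin mass is needed with its exact leading coefficient 1 / t^2,
    since it multiplies a harmonic sum. When n + 1 <= t / 2, both V_i and its competitor exceed n /
    2; as w_i <= 1, the two uniforms then lie in the corner of side 2 / n, which is the origin of
    omega_ij(2 / n). All comparisons are made between sums of indicators at each sample point and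
    integrated afterwards, so no conditioning and no integral of a tail against a density occurs. A
    box is controlled by the density bound as soon as one of its edges lies below u_0. Each
    unordered pair is met twice, with either index as the bin variable, whence the factor 2 in front
    of L. *)

(** * Expectations of combinations of indicators *)

Section mean_value.
Context (R : realType) (d : measure_display) (T : measurableType d)
  (P : probability T R).

(** Events are Boolean predicates, so that the same term can be read as a 0/1-valued real in the
    pointwise inequalities. *)
Definition pr (b : T -> bool) : R := fine (P [set x | b x]).

(** Integrability is bundled with the value of the integral, so that finite sums and differences of
    indicators are integrated by following the shape of the expression. *)
Definition has_mean (f : T -> R) (r : R) : Prop :=
  P.-integrable setT (EFin \o f) /\ (\int[P]_x (f x)%:E = r%:E)%E.

Lemma pr_fin_num (A : set T) : measurable A -> P A \is a fin_num.
Proof. by move=> mA; exact: fin_num_measure. Qed.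

Lemma prE (b : T -> bool) : measurable [set x | b x] ->
  P [set x | b x] = (pr b)%:E.
Proof. by move=> mb; rewrite /pr fineK// pr_fin_num. Qed.

Lemma has_mean_pr (b : T -> bool) : measurable [set x | b x] ->
  has_mean (fun x => (b x)%:R) (pr b).
Proof.
move=> mb; have E : (fun x => (b x)%:R : R) = \1_[set x | b x].
  by apply/funext => x; rewrite indicE mem_setE.
rewrite E; split; first exact: integrable_indic.
rewrite integral_indic// setIT; exact: prE.
Qed.

Lemma has_meanD (f g : T -> R) (r s : R) : has_mean f r -> has_mean g s ->
  has_mean (fun x => f x + g x) (r + s).
Proof.
move=> [fi fr] [gi gs]; split; last first.
  by under eq_integral do rewrite EFinD; rewrite integralD// fr gs.
by have := integrableD measurableT fi gi; apply: eq_integrable.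
Qed.

Lemma has_meanN (f : T -> R) (r : R) : has_mean f r ->
  has_mean (fun x => - f x) (- r).
Proof.
move=> [fi fr]; split.
  have := @integrableZl _ _ _ P _ measurableT (-1) _ fi.
  by apply: eq_integrable => // x _ /=; rewrite -EFinM mulN1r.
under eq_integral do rewrite -mulN1r EFinM.
by rewrite integralZl// fr -EFinM mulN1r.
Qed.

Lemma has_meanB (f g : T -> R) (r s : R) : has_mean f r -> has_mean g s ->
  has_mean (fun x => f x - g x) (r - s).
Proof. by move=> fr /has_meanN; exact: has_meanD. Qed.

Lemma has_mean_sum (I : Type) (s : seq I) (Q : pred I) (f : I -> T -> R)
    (r : I -> R) : (forall i, Q i -> has_mean (f i) (r i)) ->
  has_mean (fun x => \sum_(i <- s | Q i) f i x) (\sum_(i <- s | Q i) r i).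
Proof.
move=> fr; elim: s => [|i s IH].
  rewrite big_nil; under [X in has_mean X _]eq_fun do rewrite big_nil.
  split; last by rewrite integral_cst// mul0e.
  exact: (@integrable0 _ _ _ P setT).
rewrite big_cons; under [X in has_mean X _]eq_fun do rewrite big_cons.
by case: ifP => // /fr; move/has_meanD; exact.
Qed.

Lemma le_has_mean (f g : T -> R) (r s : R) : has_mean f r -> has_mean g s ->
  (forall x, f x <= g x) -> r <= s.
Proof.
move=> [fi fr] [gi gs] fg; rewrite -lee_fin -fr -gs.
by apply: le_integral => // x _; rewrite lee_fin.
Qed.

End mean_value.

(** * Pointwise inequalities between indicators *)

Section pointwise.
Context (R : realType).

Lemma ler_term_sum (I : eqType) (r : seq I) (Q : pred I) (f : I -> R) i :
  i \in r -> Q i -> (forall j, Q j -> 0 <= f j) -> f i <= \sum_(j <- r | Q j) f j.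
Proof.
move=> ir Qi f0; rewrite (big_rem i)//= Qi lerDl; exact: sumr_ge0.
Qed.

(** Meant for disjoint bins or cells, where at most one term is positive. The index [i] may lie
    outside [r], which is where [0 <= c] is used. *)
Lemma ler_sum_single (I : eqType) (r : seq I) (f : I -> R) i c : uniq r ->
  0 <= c -> f i <= c -> (forall j, j \in r -> j != i -> f j <= 0) ->
  \sum_(j <- r) f j <= c.
Proof.
move=> ur c0 fi f0; have [ir|ir] := boolP (i \in r).
  rewrite (bigD1_seq i)//= -[leRHS]addr0 lerD// big_seq_cond.
  by apply: sumr_le0 => j /andP[]; exact: f0.
rewrite big_seq; apply: le_trans c0; apply: sumr_le0 => j jr.
by apply: f0 => //; apply: contraNneq ir => <-.
Qed.

(* With z the number of true b_i, the left-hand side is z - (z^2 - z) <= 1. *)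
Lemma bonferroni_bool (I : finType) (Q : pred I) (b : I -> bool) :
  \sum_(i | Q i) (b i)%:R -
    \sum_(i | Q i) \sum_(j | Q j && (j != i)) (b i && b j)%:R
  <= ([exists i, Q i && b i])%:R :> R.
Proof.
pose z := (\sum_(i | Q i) b i)%N.
have Ez : \sum_(i | Q i) (b i)%:R = z%:R :> R by rewrite natr_sum.
have Ezz : \sum_(i | Q i) \sum_(j | Q j && (j != i)) (b i && b j)%:R
    = z%:R ^+ 2 - z%:R :> R.
  rewrite -Ez expr2 mulr_suml -sumrB; apply: eq_bigr => i Qi.
  rewrite mulr_sumr [in RHS](bigD1 i)//= -natrM mulnb andbb addrAC subrr add0r.
  by apply: eq_bigr => j _; rewrite -natrM mulnb.
rewrite Ez Ezz; have [e|e] := boolP [exists i, Q i && b i].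
  by rewrite /=; have := sqr_ge0 (z%:R - 1 : R); nra.
rewrite (_ : z = 0%N); first by rewrite expr0n/= !subr0.
apply/eqP; rewrite sum_nat_eq0; apply/forall_inP => i Qi.
by rewrite eqb0; apply: contraNN e => bi; apply/existsP; exists i; rewrite Qi.
Qed.

Context (m : nat) (v : 'I_m -> R) (v_ge0 : forall i, 0 <= v i).

(** Pigeonhole: otherwise each of the at most m selected terms is at most n / m. *)
Lemma exists_large (Q : pred 'I_m) (n : R) : 0 <= n -> n < \sum_(j | Q j) v j ->
  exists2 j, Q j & n / m%:R < v j.
Proof.
move=> n0; rewrite ltNge => /negP h; apply: contrapT => h'; apply: h.
(* For m = 0 the sum is empty, and the last term restores n. *)
have -> : n = \sum_(j < m) n / m%:R + (m == 0)%N%:R * n.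
  rewrite sumr_const card_ord -[_ *+ m]mulr_natr; have [->|m0] := eqVneq m 0%N.
    by rewrite mulr0 add0r mul1r.
  by rewrite mul0r addr0 mulfVK// pnatr_eq0.
rewrite -[leLHS]addr0 lerD// ?mulr_ge0//.
rewrite big_mkcond; apply: ler_sum => j _; case: ifP => Qj.
  by rewrite leNgt; apply/negP => jn; apply: h'; exists j.
by rewrite divr_ge0.
Qed.

(** Some v_j exceeds n / m. If every other selected term is at most s / m, these add up to at most
    s, and v_j alone exceeds n - s. *)
Lemma one_or_two_large (Q : pred 'I_m) (n s : R) : 0 <= s -> 0 <= n ->
  n < \sum_(j | Q j) v j ->
  (exists2 j, Q j & n - s < v j) \/
  (exists j k, [/\ Q j, Q k, k != j, n / m%:R < v j & s / m%:R < v k]).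
Proof.
move=> s0 n0 h; have [j Qj nj] := exists_large n0 h.
have [[k /andP[Qk kj] sk]|nk] :=
  pselect (exists2 k, Q k && (k != j) & s / m%:R < v k).
  by right; exists j, k.
left; exists j => //; rewrite ltrBlDr; apply: (lt_le_trans h).
rewrite (bigD1 j)//= lerD2l leNgt; apply/negP => /(exists_large s0) [k Qk sk].
by apply: nk; exists k.
Qed.

(* If no v_i exceeds t and no two of them are of order t, then one v_i lies in
   some bin ]t - n - 1, t - n] while the others add up to more than n. *)
Lemma upper_pointwise (t : R) (N K : nat) : 4 <= t -> t / 2 < K.+1%:R ->
  (t < \sum_i v i)%R%:R <=
  \sum_i (t < v i)%R%:R +
  \sum_i \sum_(j | j != i) ((t / m%:R < v i) && (t / 4 / m%:R < v j))%R%:R +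
  \sum_i (t - N%:R < v i <= t)%R%:R +
  \sum_i \sum_(N <= n < K)
    (\sum_(j | j != i)
       ((t - n.+1%:R < v i <= t - n%:R) && (n%:R - Num.sqrt n%:R < v j))%R%:R +
     \sum_(j | j != i) \sum_(k | (k != i) && (k != j))
       [&& t - n.+1%:R < v i <= t - n%:R, n%:R / m%:R < v j &
           Num.sqrt n%:R / m%:R < v k]%R%:R) :> R.
Proof.
move=> t4 tK.
set A := \sum_i (t < v i)%R%:R; set B := \sum_i \sum_(j | _) _.
set C := \sum_i (_ < v i <= t)%R%:R; set D := \sum_i \sum_(N <= n < K) _.
have A0 : 0 <= A by apply: sumr_ge0.
have B0 : 0 <= B by apply: sumr_ge0 => i _; apply: sumr_ge0.
have C0 : 0 <= C by apply: sumr_ge0.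
have D0 : 0 <= D.
  apply: sumr_ge0 => i _; apply: sumr_ge0 => n _.
  by rewrite addr_ge0 ?sumr_ge0// => j _; rewrite sumr_ge0.
case: ltP => [tS|_]; last by rewrite !addr_ge0.
rewrite -[true%:R]/(1 : R); suff : [\/ 1 <= A, 1 <= B, 1 <= C | 1 <= D] by case; lra.
have ht : 0 <= t / 4 by lra.
have t0 : 0 <= t by lra.
(* The margin s = t / 4 leaves either a single v_i > 3 t / 4 or two values of order t. *)
have [[i _ ti]|[i [j [_ _ ji ti tj]]]] := one_or_two_large ht t0 tS; last first.
  apply: Or42; apply: (le_trans _ (ler_term_sum (mem_index_enum i) isT _)) => //.
    rewrite /=; apply: (le_trans _ (ler_term_sum (mem_index_enum j) ji _)) => //.
    by rewrite ti tj.
  by move=> k _; exact: sumr_ge0.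
have [tvi|vit] := ltP t (v i).
  by apply: Or41; apply: le_trans (ler_term_sum (mem_index_enum i) isT _); rewrite ?tvi.
have [tNvi|viN] := ltP (t - N%:R) (v i).
  apply: Or43; apply: le_trans (ler_term_sum (mem_index_enum i) isT _) => //.
  by rewrite tNvi vit.
apply: Or44; have tv0 : 0 <= t - v i by rewrite subr_ge0.
have /andP[n1 n2] := truncn_itv tv0; set n := Num.truncn (t - v i) in n1 n2.
have Nn : (N <= n)%N by rewrite truncn_ge_nat//; lra.
(* Since v_i > 3 t / 4, the bin index is below t / 4, and t / 4 <= t / 2 - 1 < K because t >= 4. *)
have nK : (n < K)%N by move: tK; rewrite -(ltr_nat R) -[K.+1%:R]natr1; lra.
have bin : t - n.+1%:R < v i <= t - n%:R by lra.
have nin : n \in index_iota N K by rewrite mem_index_iota Nn.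
have nS : n%:R < \sum_(j | j != i) v j.
  by move: tS; rewrite (bigD1 i)//=; lra.
apply: le_trans (ler_term_sum (mem_index_enum i) isT _) => /=; last first.
  move=> k _; apply: sumr_ge0 => l _.
  by rewrite addr_ge0 ?sumr_ge0// => j _; rewrite sumr_ge0.
apply: le_trans (ler_term_sum nin isT _) => /=; last first.
  by move=> l _; rewrite addr_ge0 ?sumr_ge0// => j _; rewrite sumr_ge0.
have [[j ji nj]|[j [k [ji ki kj nj nk]]]] :=
    one_or_two_large (sqrtr_ge0 n%:R) (ler0n _ n) nS.
  rewrite -[leLHS]addr0 lerD//; last by apply: sumr_ge0 => j' _; rewrite sumr_ge0.
  apply: le_trans (ler_term_sum (mem_index_enum j) ji _) => //.
  by rewrite bin nj.
rewrite -[leLHS]add0r lerD ?sumr_ge0//.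
apply: le_trans (ler_term_sum (mem_index_enum j) ji _) => /=; last first.
  by move=> l _; rewrite sumr_ge0.
apply: le_trans (ler_term_sum (mem_index_enum k) _ _) => //=; last by rewrite ki.
by rewrite bin nj nk.
Qed.

(** Bonferroni is applied twice: over i to the events [a i], two of which can hold only if two
    values exceed t / 2, and inside each bin over the competitors j. For fixed i, exceeding t and
    lying in one of the bins are disjoint, so these contributions add up to at most the indicator of
    [a i]. *)
Lemma lower_pointwise (t : R) (N K : nat) : 0 < t -> K%:R <= t / 2 ->
  \sum_i ((t < v i)%R%:R + \sum_(N <= n < K)
    (\sum_(j | j != i)
       ((t - n.+1%:R < v i <= t - n%:R) && (n.+1%:R < v j))%R%:R -
     \sum_(j | j != i) \sum_(k | (k != i) && (k != j))
       [&& t - n.+1%:R < v i <= t - n%:R, n.+1%:R < v j & n.+1%:R < v k]%R%:R)) -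
  \sum_i \sum_(j | j != i) ((t / 2 < v i) && (t / 2 < v j))%R%:R
  <= (t < \sum_i v i)%R%:R :> R.
Proof.
move=> t0 Kt; pose a i := (t / 2 < v i) && (t < \sum_i v i).
have v_le i (Q : pred 'I_m) : Q i -> v i <= \sum_(j | Q j) v j.
  by move=> Qi; exact: ler_term_sum (mem_index_enum i) Qi _.
apply: (@le_trans _ _ (\sum_i (a i)%:R - \sum_i \sum_(j | j != i) (a i && a j)%:R)).
  apply: lerB; last first.
    apply: ler_sum => i _; apply: ler_sum => j _; rewrite ler_nat /a.
    by case: (t / 2 < v i) => //=; case: (t / 2 < v j); rewrite ?andbF ?leq_b1.
  apply: ler_sum => i _.
  pose e n := (t - n.+1%:R < v i <= t - n%:R) &&
              [exists j, (j != i) && (n.+1%:R < v j)].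
  apply: (@le_trans _ _ ((t < v i)%R%:R + \sum_(N <= n < K) (e n)%:R)).
    rewrite lerD2l; apply: ler_sum => n _; rewrite /e.
    case: (t - _ < v i <= _) => /=; first exact: bonferroni_bool.
    by rewrite [X in X - _]big1// [X in _ - X]big1 ?subrr// => j _; rewrite big1.
  (* A competitor above n + 1 rather than n makes up for the width of the bin, so the sum exceeds t;
     and n + 1 <= K <= t / 2 gives v_i > t / 2. *)
  have e_a n : (n < K)%N -> e n -> a i.
    rewrite -(ler_nat R) => nK /andP[/andP[b1 b2] /existsP[j /andP[ji nj]]].
    apply/andP; split; first by lra.
    by rewrite (bigD1 i)//=; have := v_le j (fun j => j != i) ji; lra.
  have [tvi|vit] := ltP t (v i).
    rewrite (_ : a i = true) /=; last first.
      rewrite /a; apply/andP; split; first by lra.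
      by apply: lt_le_trans tvi _; exact: v_le.
    rewrite [X in _ + X]big1 ?addr0// => n _; rewrite /e.
    by rewrite [v i <= _]leNgt (_ : t - n%:R < v i) ?andbF//; have := ler0n R n; lra.
  rewrite add0r; have tv0 : 0 <= t - v i by rewrite subr_ge0.
  rewrite big_seq big_mkcond/=.
  apply: (@ler_sum_single _ _ _ (Num.truncn (t - v i))); rewrite ?iota_uniq//.
    case: ifP => //; rewrite mem_index_iota => /andP[_ nK].
    by rewrite ler_nat; case: (e _) (e_a _ nK) => // ->.
  move=> n nNK nt; rewrite nNK /e.
  suff -> : (t - n.+1%:R < v i <= t - n%:R) = false; first by [].
  apply/negP => b; move/eqP: nt; apply; apply/esym/truncn_def; lra.
apply: (le_trans (@bonferroni_bool _ predT a)).
by rewrite ler_nat; case: existsP => // -[i /andP[_ /andP[_ ->]]].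
Qed.

End pointwise.

(** * Elementary estimates *)

Section elementary_estimates.
Context (R : realType).
Implicit Types t n r a k o M : R.

(** The probability that V_i lies in ]t - n - 1, t - n], divided by w_i. *)
Definition bin_mass t n : R := 1 / (t - (n + 1)) - 1 / (t - n).

Lemma bin_massE t n : n + 1 <= t / 2 -> 0 < t ->
  bin_mass t n = 1 / ((t - (n + 1)) * (t - n)).
Proof.
by move=> nt t0; rewrite /bin_mass; field; apply/andP; split; apply/eqP; lra.
Qed.

Lemma bin_mass_ge t n : 0 <= n -> n + 1 <= t / 2 -> 0 < t ->
  1 / t ^+ 2 <= bin_mass t n.
Proof.
move=> n0 nt t0; rewrite bin_massE// !div1r lef_pV2 ?posrE ?exprn_gt0//; first nra.
by apply: mulr_gt0; lra.
Qed.

Lemma bin_mass_le4 t n : 0 <= n -> n + 1 <= t / 2 -> 0 < t ->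
  bin_mass t n <= 4 / t ^+ 2.
Proof.
move=> n0 nt t0; rewrite bin_massE//.
have p0 : 0 < (t - (n + 1)) * (t - n) by apply: mulr_gt0; lra.
rewrite ler_pdivrMr// mulrAC ler_pdivlMr ?exprn_gt0//; nra.
Qed.

(** The crude factor 4 of [bin_mass_le4] would spoil the constant of the logarithm. Here the excess
    n / t^3, once divided by n, adds up over n <= t / 2 to O(t^-2). *)
Lemma bin_mass_le t n : 4 <= n -> n + 1 <= t / 2 -> 0 < t ->
  bin_mass t n <= 1 / t ^+ 2 + 10 * n / t ^+ 3.
Proof.
move=> n0 nt t0; rewrite bin_massE//.
have p0 : 0 < (t - (n + 1)) * (t - n) by apply: mulr_gt0; lra.
have -> : 1 / t ^+ 2 + 10 * n / t ^+ 3 = (t + 10 * n) / t ^+ 3.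
  by field; rewrite gt_eqF.
rewrite ler_pdivrMr// mulrAC ler_pdivlMr ?exprn_gt0// mul1r.
(* With p the product of the two factors, t p >= t^3 - 2 (n + 1) t^2 and 10 n p >= (5 / 2) n t^2.
   The constant 10 works because (5 / 2) n >= 2 (n + 1) for n >= 4. *)
have : t ^+ 2 * (t - 2 * (n + 1)) <= t * ((t - (n + 1)) * (t - n)) by nra.
have : t ^+ 2 <= 4 * ((t - (n + 1)) * (t - n)) by nra.
rewrite !exprS expr0 => h1 h2; nra.
Qed.

(** Here [r] is the square root of n, and n >= 4 amounts to r <= n / 2. The third bound shows that
    lowering the threshold by r costs only a summable term. *)
Lemma invf_sub_sqrt n r : 4 <= n -> 0 <= r -> r ^+ 2 = n ->
  [/\ 0 < n - r, n / 2 <= n - r, 1 / (n - r) <= 1 / n + 2 / (n * r) &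
      1 / (n - r) <= 2 / n].
Proof.
move=> n4 r0 rn; have r2 : 2 <= r by nra.
have nr : n - r >= n / 2 by nra.
have nr0 : 0 < n - r by lra.
have n0 : 0 < n by lra.
split => //; last by rewrite ler_pdivrMr// mulrAC ler_pdivlMr//; lra.
have -> : 1 / n + 2 / (n * r) = (r + 2) / (n * r).
  by field; apply/andP; split; apply/eqP; lra.
by rewrite ler_pdivrMr// mulrAC ler_pdivlMr ?mulr_gt0//; nra.
Qed.

(** [k] stands for the pair coefficient and [o] for the corner modulus. The three errors come from
    the bin mass, from the lowered threshold and from the modulus; in them [k] is replaced by its
    bound [M], so that the first two are uniform over the pairs. *)
Lemma upper_term t n r k o M : 4 <= n -> 0 <= r -> r ^+ 2 = n ->
  n + 1 <= t / 2 -> 0 < t -> 0 <= k <= M -> 0 <= o ->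
  (k + o) * bin_mass t n / (n - r) <=
  k * (1 / n / t ^+ 2) + (10 * M / t ^+ 3 + 8 * M / t ^+ 2 * (1 / (n * r)) +
  8 / t ^+ 2 * (o / n)).
Proof.
move=> n4 r0 rn nt t0 /andP[k0 kM] o0.
have [nr0 _ nr1 nr2] := invf_sub_sqrt n4 r0 rn.
have n0 : 0 < n by lra.
have d1 := bin_mass_le n4 nt t0.
have d2 : bin_mass t n <= 4 / t ^+ 2 by apply: bin_mass_le4 => //; lra.
have r2 : 2 <= r by nra.
have d0 : 0 <= bin_mass t n.
  by rewrite bin_massE// divr_ge0// mulr_ge0//; lra.
rewrite -mulrA mulrDl.
have t2 : 0 <= 4 / t ^+ 2 by rewrite divr_ge0 ?exprn_ge0// ltW.
have onr : o * (bin_mass t n / (n - r)) <= 8 / t ^+ 2 * (o / n).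
  rewrite (_ : 8 / t ^+ 2 * (o / n) = o * (4 / t ^+ 2 * (2 / n))); last first.
    by field; rewrite !gt_eqF.
  apply: ler_wpM2l => //; rewrite -[bin_mass _ _ / _]mulr1 -mulrA.
  rewrite [_^-1 * 1]mulrC; apply: ler_pM => //.
  by rewrite divr_ge0// ltW.
have knr : k * (bin_mass t n / (n - r)) <=
    k * (1 / n / t ^+ 2) + (10 * M / t ^+ 3 + 8 * M / t ^+ 2 * (1 / (n * r))).
  apply: (@le_trans _ _ (k * (1 / n / t ^+ 2 + 10 / t ^+ 3 + 8 / t ^+ 2 * (1 / (n * r))))).
    apply: ler_wpM2l => //.
    apply: (@le_trans _ _ (bin_mass t n * (1 / n + 2 / (n * r)))).
      by apply: ler_wpM2l => //; rewrite -div1r.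
    rewrite mulrDr; apply: lerD.
      rewrite (_ : 1 / n / t ^+ 2 + 10 / t ^+ 3 = (1 / t ^+ 2 + 10 * n / t ^+ 3) * (1 / n)).
        by rewrite ler_wpM2r// divr_ge0// ltW.
      by field; rewrite !gt_eqF.
    rewrite (_ : 8 / t ^+ 2 * (1 / (n * r)) = 4 / t ^+ 2 * (2 / (n * r))).
      by rewrite ler_wpM2r// divr_ge0// mulr_ge0// ltW.
    by field; rewrite !gt_eqF//; lra.
  have c0 : 0 <= 10 / t ^+ 3 + 8 / t ^+ 2 * (1 / (n * r)).
    have t0' := ltW t0; have n0' := ltW n0.
    by rewrite addr_ge0// !(mulr_ge0, invr_ge0, exprn_ge0).
  rewrite -[1 / n / t ^+ 2 + _ + _]addrA [leLHS]mulrDr lerD2l.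
  apply: le_trans (ler_wpM2r c0 kM) _.
  by rewrite le_eqVlt; apply/orP; left; apply/eqP; ring.
by rewrite addrA; exact: lerD.
Qed.

(** The main term needs no correction, because the bin mass is at least 1 / t^2. *)
Lemma lower_term t n k o : 0 < n -> n + 1 <= t / 2 -> 0 < t -> 0 <= k -> 0 <= o ->
  k * (1 / (n + 1) / t ^+ 2) - 4 / t ^+ 2 * (o / n) <=
  (k - o) * bin_mass t n / (n + 1).
Proof.
move=> n0 nt t0 k0 o0; have d1 := bin_mass_ge (ltW n0) nt t0.
have d2 := bin_mass_le4 (ltW n0) nt t0.
have n10 : 0 < n + 1 by lra.
have d0 : 0 <= bin_mass t n by apply: le_trans d1; rewrite divr_ge0// exprn_ge0// ltW.
rewrite -[leRHS]mulrA [leRHS]mulrBl lerB//.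
  rewrite ler_wpM2l// [leLHS]mulrAC; apply: ler_wpM2r; last by rewrite mul1r -div1r.
  by rewrite invr_ge0 ltW.
rewrite (_ : 4 / t ^+ 2 * (o / n) = o * (4 / t ^+ 2 / n)); last first.
  by rewrite mulrCA.
apply: ler_wpM2l => //; apply: ler_pM; rewrite ?invr_ge0 ?(ltW n10)//.
by rewrite lef_pV2 ?posrE//; lra.
Qed.

(** Both bounds are ln (1 + x) <= x, at x = 1 / n and, for the inverse ratio, at x = - 1 / (n +
    1). *)
Lemma ln_ratio_bounds (n : nat) : (0 < n)%N ->
  1 / (n.+1)%:R <= ln n.+1%:R - ln n%:R :> R /\
  ln n.+1%:R - ln n%:R <= 1 / n%:R :> R.
Proof.
move=> n0; have n0' : (0 < n%:R :> R) by rewrite ltr0n.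
have n1' : (0 < n.+1%:R :> R) by rewrite ltr0n.
split.
  rewrite -[leRHS]opprK lerNr opprB -ln_div ?posrE//.
  rewrite (_ : n%:R / n.+1%:R = 1 + (- (1 / n.+1%:R))); last first.
    by rewrite -[n.+1%:R]natr1; field; rewrite natr1 gt_eqF.
  by apply: le_ln1Dx; rewrite ltrN2 ltr_pdivrMr// mul1r ltr1n.
rewrite -ln_div ?posrE//.
rewrite (_ : n.+1%:R / n%:R = 1 + 1 / n%:R); last first.
  by rewrite -[n.+1%:R]natr1; field; rewrite gt_eqF.
by apply: le_ln1Dx; apply: (@lt_le_trans _ _ 0) => //; rewrite divr_ge0// ltW.
Qed.

Lemma sum_inv_le (N K : nat) : (1 < N <= K)%N ->
  \sum_(N <= n < K) (1 / n%:R) <= ln K%:R :> R.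
Proof.
move=> /andP[N1 NK].
apply: (@le_trans _ _ (\sum_(N <= n < K) (ln n.-1.+1%:R - ln n.-1%:R))).
  rewrite big_nat [leRHS]big_nat; apply: ler_sum => n /andP[Nn _].
  have n1 : (0 < n.-1)%N by rewrite -ltnS prednK// (leq_trans _ Nn)// ltnW.
  have [+ _] := ln_ratio_bounds n1.
  by rewrite prednK// (leq_trans _ Nn)// ltnW.
have -> : \sum_(N <= n < K) (ln n.-1.+1%:R - ln n.-1%:R) =
    \sum_(N <= n < K) (ln n.+1.-1%:R - ln n.-1%:R) :> R.
  rewrite big_nat [RHS]big_nat; apply: eq_bigr => n /andP[Nn _].
  by rewrite prednK// (leq_trans _ Nn)// ltnW.
rewrite (telescope_sumr (fun n : nat => ln n.-1%:R : R))// lerBlDr.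
apply: (@le_trans _ _ (ln K%:R)); last first.
  by rewrite lerDl ln_ge0// ler1n -ltnS prednK// ltnW.
have K1 : (1 < K)%N by exact: leq_trans NK.
have K0 : (0 < K.-1)%N by case: (K) K1.
have K0' : (0 < K)%N by case: (K) K1.
by rewrite ler_ln ?posrE ?ltr0n// ler_nat leq_pred.
Qed.

Lemma sum_invS_ge (N K : nat) : (N <= K)%N ->
  ln K.+1%:R - ln N.+1%:R <= \sum_(N <= n < K) (1 / (n%:R + 1)) :> R.
Proof.
move=> NK; rewrite -(telescope_sumr (fun n : nat => ln n.+1%:R : R))//.
by apply: ler_sum => n _; rewrite natr1; have [_] := ln_ratio_bounds (ltn0Sn n).
Qed.

Lemma sum_inv_sqrt_le (N K : nat) : (0 < N)%N ->
  \sum_(N <= n < K) (1 / (n%:R * Num.sqrt n%:R)) <= 3 :> R.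
Proof.
move=> N0; apply: (@le_trans _ _ (\sum_(1 <= n < K.+1) (1 / (n%:R * Num.sqrt n%:R)))).
  have h (n : nat) : 0 <= 1 / (n%:R * Num.sqrt n%:R) :> R by rewrite divr_ge0// mulr_ge0// sqrtr_ge0.
  have [NK|/ltnW KN] := leqP N K; last by rewrite big_geq// sumr_ge0.
  rewrite [leRHS](big_cat_nat N0 (leqW NK))/=.
  rewrite (big_nat_recr _ _ _ NK)/= addrCA.
  by rewrite -[leLHS]addr0 lerD// addr_ge0// sumr_ge0.
case: K => [|K]; first by rewrite big_geq.
(* The induction is run on this stronger bound, an equality for a single term; 2 / sqrt x is the
   integral of y^(-3/2) over y > x. *)
apply: (@le_trans _ _ (3 - 2 / Num.sqrt K.+1%:R)); last first.
  by rewrite gerBl divr_ge0// sqrtr_ge0.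
elim: K => [|K IH]; first by rewrite big_nat1 sqrtr1 mulr1 divr1; lra.
rewrite big_nat_recr//=; apply: (le_trans (lerD IH (lexx _))).
have := sqr_sqrtr (ler0n R K.+1); have := sqr_sqrtr (ler0n R K.+2).
have : 0 < Num.sqrt K.+1%:R :> R by rewrite sqrtr_gt0.
have : 0 < Num.sqrt K.+2%:R :> R by rewrite sqrtr_gt0.
set a := Num.sqrt K.+1%:R; set b := Num.sqrt K.+2%:R => b0 a0 hb ha.
have ab : b ^+ 2 = a ^+ 2 + 1 by rewrite ha hb natr1.
rewrite -hb; suff : 2 / b + 1 / (b ^+ 2 * b) <= 2 / a by lra.
have -> : 2 / b + 1 / (b ^+ 2 * b) = (2 * b ^+ 2 + 1) / b ^+ 3.
  by field; rewrite gt_eqF.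
rewrite ler_pdivrMr ?exprn_gt0// mulrAC ler_pdivlMr//.
(* Writing 1 as b^2 - a^2 makes the difference homogeneous: 2 b^3 - 3 a b^2 + a^3 has the double
   root b = a. *)
rewrite -subr_ge0 (_ : _ - _ = (b - a) ^+ 2 * (2 * b + a)); last first.
  transitivity (2 * b ^+ 3 - (2 * b ^+ 2 + (b ^+ 2 - a ^+ 2)) * a); last by ring.
  by rewrite ab [_ + 1 - _]addrAC subrr add0r.
by rewrite mulr_ge0 ?sqr_ge0 ?addr_ge0 ?mulr_ge0 ?ltW.
Qed.

End elementary_estimates.

(** * Tail of a sum with controlled pair and triple boxes *)

(* To be read with V i = w_i / U_i, kap i j = lambda_ij w_i w_j, and om s bounding
   the corner moduli omega_ij at 1 / s. *)
Section tail_expansion.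
Context (R : realType) (d : measure_display) (T : measurableType d)
  (P : probability T R) (m : nat) (V : 'I_m -> T -> R) (w : 'I_m -> R)
  (kap : 'I_m -> 'I_m -> R) (om : R -> R) (x0 M : R).
Context
  (mV : forall i, measurable_fun setT (V i))
  (V_ge0 : forall i x, 0 <= V i x)
  (w_ge0 : forall i, 0 <= w i) (w_sum1 : \sum_i w i = 1)
  (x0_ge1 : 1 <= x0)
  (kap_bound : forall i j, 0 <= kap i j <= M)
  (om_ge0 : forall s, x0 <= s -> 0 <= om s)
  (V_tail : forall i x, x0 <= x -> pr P (fun y => x < V i y) = w i / x)
  (V_pair : forall i j a e, i != j -> x0 <= a -> 0 < e ->
    pr P (fun y => (a < V i y) && (e < V j y)) <= M / (a * e))
  (V_pair_bin : forall i j s a b e, i != j -> x0 <= s -> s <= a <= b -> s <= e ->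
    `|pr P (fun y => (a < V i y <= b) && (e < V j y))
      - kap i j * (1 / a - 1 / b) / e| <= om s * (1 / a - 1 / b) / e)
  (V_triple : forall i j k a b e f, j != i -> k != i -> k != j ->
    x0 <= a <= b -> 0 < e -> 0 < f ->
    pr P (fun y => [&& a < V i y <= b, e < V j y & f < V k y])
      <= M * (1 / a - 1 / b) / (e * f)).

Let S x := \sum_i V i x.
Let bin t n i x := t - n.+1%:R < V i x <= t - n%:R.

Let measurable_lt i (a : R) : measurable [set x | a < V i x].
Proof.
rewrite (_ : mkset _ = setT `&` V i @^-1` `]a, +oo[); first exact: mV.
by apply/seteqP; split => x /=; rewrite in_itv/= andbT => // -[].
Qed.

Let measurable_le i (a : R) : measurable [set x | V i x <= a].
Proof.
rewrite (_ : mkset _ = setT `&` V i @^-1` `]-oo, a]); first exact: mV.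
by apply/seteqP; split => x /=; rewrite in_itv/= => // -[].
Qed.

Let measurable_andb (b c : T -> bool) : measurable [set x | b x] ->
  measurable [set x | c x] -> measurable [set x | b x && c x].
Proof.
move=> mb mc; rewrite (_ : mkset _ = [set x | b x] `&` [set x | c x]).
  exact: measurableI.
by apply/seteqP; split => x /=; [move/andP|move=> h; apply/andP].
Qed.

Let measurable_sum_lt (a : R) : measurable [set x | a < S x].
Proof.
have mS : measurable_fun setT S by apply: measurable_sum.
rewrite (_ : mkset _ = setT `&` S @^-1` `]a, +oo[); first exact: mS.
by apply/seteqP; split => x /=; rewrite in_itv/= andbT => // -[].
Qed.

Local Ltac meas := repeat (apply: measurable_andb);
  by [exact: measurable_lt|exact: measurable_le|exact: measurable_sum_lt].

Let pr_bin i (a b : R) : a <= b ->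
  pr P (fun x => a < V i x <= b) =
  pr P (fun x => a < V i x) - pr P (fun x => b < V i x).
Proof.
move=> ab; have h1 : has_mean P (fun x => ((a < V i x <= b)%R : bool)%:R)
   (pr P (fun x => a < V i x <= b)) by apply: has_mean_pr; meas.
have h2 : has_mean P (fun x => (a < V i x)%R%:R - (b < V i x)%R%:R)
   (pr P (fun x => a < V i x) - pr P (fun x => b < V i x)).
  by apply: has_meanB; apply: has_mean_pr; meas.
have E x : (a < V i x <= b)%R%:R = (a < V i x)%R%:R - (b < V i x)%R%:R :> R.
  by case: (ltP a); case: (ltP b) => /=; rewrite ?subrr ?subr0//; lra.
by apply/eqP; rewrite eq_le (le_has_mean h1 h2) ?(le_has_mean h2 h1)// => x; rewrite E.
Qed.

Lemma tail_upper (t : R) (N K : nat) : 4 <= t -> t / 2 < K.+1%:R ->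
  pr P (fun x => t < S x) <=
  \sum_i pr P (fun x => t < V i x) +
  \sum_i \sum_(j | j != i)
     pr P (fun x => (t / m%:R < V i x) && (t / 4 / m%:R < V j x)) +
  \sum_i pr P (fun x => t - N%:R < V i x <= t) +
  \sum_i \sum_(N <= n < K)
    (\sum_(j | j != i)
       pr P (fun x => bin t n i x && (n%:R - Num.sqrt n%:R < V j x)) +
     \sum_(j | j != i) \sum_(k | (k != i) && (k != j))
       pr P (fun x => [&& bin t n i x, n%:R / m%:R < V j x &
           Num.sqrt n%:R / m%:R < V k x])).
Proof.
move=> t4 tK.
have := fun x => @upper_pointwise _ _ (V ^~ x) t N K t4 tK; cbv beta.
apply: le_has_mean; first exact: has_mean_pr (measurable_sum_lt t).
by repeat (apply: has_meanD || (apply: has_mean_sum => * )); apply: has_mean_pr; meas.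
Qed.

Lemma tail_lower (t : R) (N K : nat) : 0 < t -> K%:R <= t / 2 ->
  \sum_i (pr P (fun x => t < V i x) + \sum_(N <= n < K)
    (\sum_(j | j != i) pr P (fun x => bin t n i x && (n.+1%:R < V j x)) -
     \sum_(j | j != i) \sum_(k | (k != i) && (k != j))
       pr P (fun x => [&& bin t n i x, n.+1%:R < V j x & n.+1%:R < V k x]))) -
  \sum_i \sum_(j | j != i) pr P (fun x => (t / 2 < V i x) && (t / 2 < V j x))
  <= pr P (fun x => t < S x).
Proof.
move=> t0 Kt.
have := fun x => @lower_pointwise _ _ (V ^~ x) (V_ge0 ^~ x) t N K t0 Kt; cbv beta.
apply: le_has_mean; last exact: has_mean_pr (measurable_sum_lt t).
by repeat (apply: has_meanB || apply: has_meanD || (apply: has_mean_sum => * ));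
   apply: has_mean_pr; meas.
Qed.

Lemma sum_le_card (Q : pred 'I_m) (f : 'I_m -> R) (c : R) : 0 <= c ->
  (forall j, Q j -> f j <= c) -> \sum_(j | Q j) f j <= m%:R * c.
Proof.
move=> c0 fc; apply: (@le_trans _ _ (\sum_(j < m) c)).
  by rewrite big_mkcond; apply: ler_sum => j _; case: ifP => // /fc.
by rewrite sumr_const card_ord -[_ *+ _]mulr_natl.
Qed.

Let m_gt0 : 0 < m%:R :> R.
Proof.
rewrite ltr0n lt0n; apply/eqP => m0; move: w_sum1; rewrite big1.
  by move/esym/eqP; rewrite oner_eq0.
by move=> -[i im]; exfalso; move: im; rewrite m0.
Qed.

Let M_ge0 : 0 <= M.
Proof.
have i : 'I_m by apply: (Ordinal (n := m) (m := 0)); rewrite -(ltr0n R) m_gt0.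
by have /andP[] := kap_bound i i; exact: le_trans.
Qed.

Let kapS := \sum_i \sum_(j | j != i) kap i j.
Let W (N K : nat) := \sum_(N <= n < K) om (n%:R / 2) / n%:R.
(** The summands account for two values of order t, for the window ]t - N, t], for the pairs in the
    bins and for the triples. The coefficient 29 is 5 + 8 * 3, where 3 bounds the sum of
    n^(-3/2). *)
Let C (N : nat) (W : R) := 4 * m%:R ^+ 4 * M + 2 * N%:R +
  m%:R ^+ 2 * (29 * M + 8 * W) + 12 * m%:R ^+ 5 * M.

Lemma tail_upper_bound (t : R) (N K : nat) : (4 <= N)%N -> 2 * x0 <= N%:R ->
  2 * N%:R <= t -> 2 * x0 * m%:R <= t -> K%:R <= t / 2 < K.+1%:R ->
  pr P (fun x => t < S x) <= 1 / t + kapS * (ln t / t ^+ 2) + C N (W N K) / t ^+ 2.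
Proof.
move=> N4 x0N Nt x0t /andP[Kt tK].
have N4' : 4 <= N%:R :> R by rewrite (ler_nat R 4 N).
have t4 : 4 <= t by lra.
have t0 : 0 < t by lra.
have M0 := M_ge0; have m0 := m_gt0.
have m1 : 1 <= m%:R :> R by rewrite ler1n -(ltr0n R).
apply: (le_trans (@tail_upper t N K t4 tK)).
have NK : (N <= K)%N by rewrite -ltnS -(ltr_nat R); lra.
have t20 : 0 < t ^+ 2 by rewrite exprn_gt0.
have x0t' : x0 <= t by nra.
have E1 : \sum_i pr P (fun x => t < V i x) = 1 / t.
  by rewrite -w_sum1 mulr_suml; apply: eq_bigr => i _; exact: V_tail.
have E2 : \sum_i \sum_(j | j != i)
     pr P (fun x => (t / m%:R < V i x) && (t / 4 / m%:R < V j x))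
     <= 4 * m%:R ^+ 4 * M / t ^+ 2.
  have c0 : 0 <= 4 * m%:R ^+ 2 * M / t ^+ 2.
    by rewrite !(mulr_ge0, invr_ge0, exprn_ge0)// ltW.
  apply: (@le_trans _ _ (m%:R * (m%:R * (4 * m%:R ^+ 2 * M / t ^+ 2)))); last first.
    by rewrite le_eqVlt; apply/orP; left; apply/eqP; field; rewrite gt_eqF.
  apply: sum_le_card => [|i _]; first by rewrite mulr_ge0// ltW.
  apply: sum_le_card => // j ji.
  have := @V_pair i j (t / m%:R) (t / 4 / m%:R).
  rewrite eq_sym ji => /(_ isT); rewrite ler_pdivlMr// => H.
  apply: le_trans (H _ _) _.
  - by have := mulr_ge0 (le_trans ler01 x0_ge1) (ltW m0); lra.
  - by rewrite !divr_gt0.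
  - by rewrite le_eqVlt; apply/orP; left; apply/eqP; field; rewrite !gt_eqF.
have E3 : \sum_i pr P (fun x => t - N%:R < V i x <= t) <= 2 * N%:R / t ^+ 2.
  apply: (@le_trans _ _ (\sum_i w i * (2 * N%:R / t ^+ 2))); last first.
    by rewrite -mulr_suml w_sum1 mul1r.
  apply: ler_sum => i _; rewrite pr_bin; last by lra.
  rewrite !V_tail//; last by lra.
  rewrite -mulrBr ler_wpM2l//.
  rewrite (_ : _ - _ = N%:R / ((t - N%:R) * t)); last first.
    by field; apply/andP; split; apply/eqP; lra.
  have p0 : 0 < (t - N%:R) * t by rewrite mulr_gt0//; lra.
  have q0 : 0 <= N%:R * t * (t - 2 * N%:R) by rewrite !mulr_ge0//; lra.
  by rewrite ler_pdivrMr// mulrAC ler_pdivlMr//; nra.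
(* [g n] bounds the error of one pair in the bin n, and [h n] the contribution of one triple. *)
pose g (n : nat) := 10 * M / t ^+ 3 + 8 * M / t ^+ 2 * (1 / (n%:R * Num.sqrt n%:R)) +
  8 / t ^+ 2 * (om (n%:R / 2) / n%:R).
pose h (n : nat) := 4 * M * m%:R ^+ 2 / t ^+ 2 * (1 / (n%:R * Num.sqrt n%:R)).
have nfacts (n : nat) : (N <= n < K)%N ->
   [/\ 4 <= n%:R :> R, x0 <= n%:R / 2, n%:R + 1 <= t / 2 &
       Num.sqrt n%:R ^+ 2 = n%:R :> R].
  move=> /andP[]; rewrite -(ler_nat R) -(ler_nat R) -[n.+1%:R]natr1 => Nn nK.
  by split; try lra; rewrite sqr_sqrtr.
have g0 n : (N <= n < K)%N -> 0 <= g n.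
  move=> /nfacts[n4 x0n nt rn]; have o0 := om_ge0 x0n.
  by rewrite !addr_ge0// !(mulr_ge0, invr_ge0, exprn_ge0)// ?sqrtr_ge0// ltW.
have h0 n : 0 <= h n.
  by rewrite !(mulr_ge0, invr_ge0, exprn_ge0)// ?sqrtr_ge0// ltW.
have E4 i n : (N <= n < K)%N ->
    (\sum_(j | j != i)
       pr P (fun x => bin t n i x && (n%:R - Num.sqrt n%:R < V j x)) +
     \sum_(j | j != i) \sum_(k | (k != i) && (k != j))
       pr P (fun x => [&& bin t n i x, n%:R / m%:R < V j x &
           Num.sqrt n%:R / m%:R < V k x])) <=
   (\sum_(j | j != i) kap i j) * (1 / n%:R / t ^+ 2) +
   (m%:R * g n + m%:R * (m%:R * h n)).
  move=> nNK; have [n4 x0n nt rn] := nfacts n nNK.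
  have r0 := sqrtr_ge0 (n%:R : R).
  have [nr0 hr _ _] := invf_sub_sqrt n4 r0 rn.
  rewrite addrA lerD//; last first.
    apply: sum_le_card => [|j ji]; first by rewrite mulr_ge0// ltW.
    apply: sum_le_card => // k /andP[ki kj].
    apply: le_trans (V_triple ji ki kj _ _ _) _.
    - by rewrite -natr1; apply/andP; split; lra.
    - by rewrite divr_gt0//; lra.
    - by rewrite divr_gt0// sqrtr_gt0; lra.
    rewrite -[n.+1%:R]natr1 -/(bin_mass t n%:R) /h.
    have r0' : 0 < Num.sqrt n%:R :> R by rewrite sqrtr_gt0; lra.
    rewrite (_ : _ / _ = M * m%:R ^+ 2 * (1 / (n%:R * Num.sqrt n%:R)) * bin_mass t n%:R); last first.
      by field; apply/and3P; split; rewrite ?gt_eqF//; lra.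
    apply: (@le_trans _ _ (M * m%:R ^+ 2 * (1 / (n%:R * Num.sqrt n%:R)) * (4 / t ^+ 2))).
      apply: ler_wpM2l; last by apply: bin_mass_le4 => //; lra.
      by rewrite !(mulr_ge0, invr_ge0, exprn_ge0)// ltW.
    rewrite le_eqVlt; apply/orP; left; apply/eqP; field.
    by apply/and3P; split; rewrite ?gt_eqF//; lra.
  rewrite mulr_suml -lerBlDl -sumrB; apply: sum_le_card; first exact: g0.
  move=> j ji; rewrite lerBlDl.
  apply: le_trans (@upper_term _ t n%:R (Num.sqrt n%:R) (kap i j)
    (om (n%:R / 2)) M n4 r0 rn nt t0 (kap_bound i j) (om_ge0 x0n)).
  (* Both thresholds, t - n - 1 and n - sqrt n, are at least n / 2, so the modulus may be taken at s
     = n / 2. *)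
  have := @V_pair_bin i j (n%:R / 2) (t - n.+1%:R) (t - n%:R) (n%:R - Num.sqrt n%:R).
  rewrite eq_sym ji => /(_ isT x0n); rewrite -[n.+1%:R]natr1 => H.
  have hb : n%:R / 2 <= t - (n%:R + 1) <= t - n%:R by apply/andP; split; lra.
  have /ler_normlP[_] := H hb hr; rewrite -/(bin_mass t n%:R) => H'.
  rewrite -[leRHS]mulrA mulrDl !mulrA -lerBlDl.
  by move: H'; rewrite /bin -[n.+1%:R]natr1.
apply: (@le_trans _ _ (1 / t + 4 * m%:R ^+ 4 * M / t ^+ 2 + 2 * N%:R / t ^+ 2 +
   \sum_i \sum_(N <= n < K) ((\sum_(j | j != i) kap i j) * (1 / n%:R / t ^+ 2) +
   (m%:R * g n + m%:R * (m%:R * h n))))).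
  rewrite E1; apply: lerD; first by apply: lerD => //; exact: lerD.
  apply: ler_sum => i _; rewrite big_nat [leRHS]big_nat.
  by apply: ler_sum => n; exact: E4.
have -> : \sum_i \sum_(N <= n < K) ((\sum_(j | j != i) kap i j) * (1 / n%:R / t ^+ 2) +
   (m%:R * g n + m%:R * (m%:R * h n))) =
   kapS * ((\sum_(N <= n < K) 1 / n%:R) / t ^+ 2) +
   m%:R * (m%:R * \sum_(N <= n < K) g n + m%:R * (m%:R * \sum_(N <= n < K) h n)).
  under eq_bigr do rewrite big_split/= -!mulr_sumr big_split/= -!mulr_sumr.
  rewrite big_split/= -mulr_suml sumr_const card_ord -[_ *+ _]mulr_natl.
  by congr (_ * _ + _); rewrite ?mulr_suml// /h -!mulr_sumr.
have F : kapS * ((\sum_(N <= n < K) 1 / n%:R) / t ^+ 2) <= kapS * (ln t / t ^+ 2).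
  apply: ler_wpM2l.
    by apply: sumr_ge0 => i _; apply: sumr_ge0 => j _; have /andP[] := kap_bound i j.
  rewrite ler_wpM2r ?invr_ge0 ?(ltW t20)//.
  apply: le_trans (sum_inv_le _ _) _; first by rewrite NK (leq_trans _ N4).
  have K0 : 0 < K%:R :> R by rewrite ltr0n (leq_trans _ NK)// (leq_trans _ N4).
  by rewrite ler_ln ?posrE//; lra.
have NK0 : (0 < N)%N by rewrite (leq_trans _ N4).
have s3 := @sum_inv_sqrt_le R N K NK0.
have G : \sum_(N <= n < K) g n <= (29 * M + 8 * W N K) / t ^+ 2.
  have -> : \sum_(N <= n < K) g n = 10 * M / t ^+ 3 *+ (K - N) +
      8 * M / t ^+ 2 * (\sum_(N <= i < K) 1 / (i%:R * Num.sqrt i%:R)) +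
      8 / t ^+ 2 * W N K.
    rewrite big_split/= big_split/= big_const_nat iter_addr_0.
    by congr (_ + _ + _); rewrite mulr_sumr.
  (* This error does not decay in n, but there are at most t / 2 bins. *)
  have k1 : 10 * M / t ^+ 3 *+ (K - N) <= 5 * M / t ^+ 2.
    apply: (@le_trans _ _ (10 * M / t ^+ 3 * (t / 2))).
      rewrite -mulr_natr ler_wpM2l//.
        by rewrite !(mulr_ge0, invr_ge0, exprn_ge0)// ltW.
      by apply: le_trans Kt; rewrite ler_nat leq_subr.
    by rewrite le_eqVlt; apply/orP; left; apply/eqP; field; rewrite gt_eqF.
  have k2 : 8 * M / t ^+ 2 * (\sum_(N <= i < K) 1 / (i%:R * Num.sqrt i%:R)) <=
     8 * M / t ^+ 2 * 3.
    by apply: ler_wpM2l => //; rewrite !(mulr_ge0, invr_ge0, exprn_ge0)// ltW.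
  apply: (le_trans (lerD (lerD k1 k2) (lexx _))).
  by rewrite le_eqVlt; apply/orP; left; apply/eqP; field; rewrite gt_eqF.
have H : \sum_(N <= n < K) h n <= 12 * M * m%:R ^+ 2 / t ^+ 2.
  apply: (@le_trans _ _ (4 * M * m%:R ^+ 2 / t ^+ 2 * 3)).
    by rewrite /h -mulr_sumr; apply: ler_wpM2l => //; rewrite !(mulr_ge0, invr_ge0, exprn_ge0)// ltW.
  by rewrite le_eqVlt; apply/orP; left; apply/eqP; field; rewrite gt_eqF.
have GH : m%:R * (m%:R * \sum_(N <= n < K) g n + m%:R * (m%:R * \sum_(N <= n < K) h n))
  <= m%:R * (m%:R * ((29 * M + 8 * W N K) / t ^+ 2) + m%:R * (m%:R * (12 * M * m%:R ^+ 2 / t ^+ 2))).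
  by do 3!(rewrite ?ler_wpM2l ?lerD ?(ltW m0)//).
apply: (le_trans (lerD (lexx _) (lerD F GH))).
rewrite le_eqVlt; apply/orP; left; apply/eqP; rewrite /C; field.
by rewrite !gt_eqF.
Qed.

(** As K + 1 > t / 2, the harmonic sum from N to K falls short of ln t by at most ln 2 + ln (N + 1),
    a constant that goes into the t^-2 term. *)
Lemma tail_lower_bound (t : R) (N K : nat) : (4 <= N)%N -> 2 * x0 <= N%:R ->
  2 * N%:R <= t -> 2 * x0 * m%:R <= t -> K%:R <= t / 2 < K.+1%:R ->
  1 / t + kapS * (ln t / t ^+ 2) -
    (kapS * (ln 2 + ln N.+1%:R) + 4 * m%:R ^+ 2 * W N K
     + 12 * m%:R ^+ 3 * M + 4 * m%:R ^+ 2 * M) / t ^+ 2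
  <= pr P (fun x => t < S x).
Proof.
move=> N4 x0N Nt x0t /andP[Kt tK].
have N4' : 4 <= N%:R :> R by rewrite (ler_nat R 4 N).
have t4 : 4 <= t by lra.
have t0 : 0 < t by lra.
have M0 := M_ge0; have m0 := m_gt0.
have m1 : 1 <= m%:R :> R by rewrite ler1n -(ltr0n R).
apply: le_trans (@tail_lower t N K t0 Kt).
have NK : (N <= K)%N by rewrite -ltnS -(ltr_nat R); lra.
have t20 : 0 < t ^+ 2 by rewrite exprn_gt0.
have x0t' : 2 * x0 <= t by nra.
have kapS0 : 0 <= kapS.
  by apply: sumr_ge0 => i _; apply: sumr_ge0 => j _; have /andP[] := kap_bound i j.
have nfacts (n : nat) : (N <= n < K)%N ->
   [/\ 4 <= n%:R :> R, x0 <= n%:R / 2, n%:R + 1 <= t / 2 &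
       Num.sqrt n%:R ^+ 2 = n%:R :> R].
  move=> /andP[]; rewrite -(ler_nat R) -(ler_nat R) -[n.+1%:R]natr1 => Nn nK.
  by split; try lra; rewrite sqr_sqrtr.
have E2 : \sum_i \sum_(j | j != i) pr P (fun x => (t / 2 < V i x) && (t / 2 < V j x))
     <= 4 * m%:R ^+ 2 * M / t ^+ 2.
  have c0 : 0 <= 4 * M / t ^+ 2 by rewrite !(mulr_ge0, invr_ge0, exprn_ge0)// ltW.
  apply: (@le_trans _ _ (m%:R * (m%:R * (4 * M / t ^+ 2)))); last first.
    by rewrite le_eqVlt; apply/orP; left; apply/eqP; field; rewrite gt_eqF.
  apply: sum_le_card => [|i _]; first by rewrite mulr_ge0// ltW.
  apply: sum_le_card => // j ji.
  have := @V_pair i j (t / 2) (t / 2); rewrite eq_sym ji => /(_ isT) H.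
  apply: le_trans (H _ _) _; [by lra|by lra|].
  by rewrite le_eqVlt; apply/orP; left; apply/eqP; field; rewrite gt_eqF.
pose g (n : nat) := 4 / t ^+ 2 * (om (n%:R / 2) / n%:R).
pose h (n : nat) := 4 * M / t ^+ 2 * (1 / (n%:R * Num.sqrt n%:R)).
have h0 n : 0 <= h n.
  by rewrite !(mulr_ge0, invr_ge0, exprn_ge0)// ?sqrtr_ge0// ltW.
have g0 n : (N <= n < K)%N -> 0 <= g n.
  move=> /nfacts[n4 x0n nt rn]; have o0 := om_ge0 x0n.
  by rewrite !(mulr_ge0, invr_ge0, exprn_ge0)// ltW.
have E4 i n : (N <= n < K)%N ->
   (\sum_(j | j != i) kap i j) * (1 / (n%:R + 1) / t ^+ 2) -
   (m%:R * g n + m%:R * (m%:R * h n)) <=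
    (\sum_(j | j != i) pr P (fun x => bin t n i x && (n.+1%:R < V j x)) -
     \sum_(j | j != i) \sum_(k | (k != i) && (k != j))
       pr P (fun x => [&& bin t n i x, n.+1%:R < V j x & n.+1%:R < V k x])).
  move=> nNK; have [n4 x0n nt rn] := nfacts n nNK.
  have r0 := sqrtr_ge0 (n%:R : R).
  rewrite opprD addrA lerB//; last first.
    apply: sum_le_card => [|j ji]; first by rewrite mulr_ge0// ltW.
    apply: sum_le_card => // k /andP[ki kj].
    apply: le_trans (V_triple ji ki kj _ _ _) _ => //.
      by rewrite -natr1; apply/andP; split; lra.
    rewrite -[n.+1%:R]natr1 -/(bin_mass t n%:R) /h.
    have r0' : 0 < Num.sqrt n%:R :> R by rewrite sqrtr_gt0; lra.
    have n10 : 0 < n%:R + 1 :> R by lra.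
    (* Here both competitors exceed n + 1; 1 / (n + 1)^2 is weakened to 1 / (n sqrt n) so that the
       same convergent series serves again. *)
    rewrite (_ : _ / t ^+ 2 * _ = M * (4 / t ^+ 2) / (n%:R * Num.sqrt n%:R)); last first.
      by field; rewrite !gt_eqF//; lra.
    apply: ler_pM.
    - rewrite mulr_ge0// (le_trans _ (bin_mass_ge _ nt t0))//.
      by rewrite divr_ge0// ltW.
    - by rewrite invr_ge0 mulr_ge0// ltW.
    - by apply: ler_wpM2l => //; apply: bin_mass_le4.
    - by rewrite lef_pV2 ?posrE ?mulr_gt0//; nra.
  rewrite lerBlDl mulr_suml -lerBlDr -sumrB.
  apply: sum_le_card; first exact: g0.
  move=> j ji; have /andP[k0 _] := kap_bound i j.
  have n0 : 0 < n%:R :> R by lra.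
  have L := @lower_term _ t n%:R (kap i j) (om (n%:R / 2)) n0 nt t0 k0 (om_ge0 x0n).
  rewrite -/(g n) in L; rewrite lerBlDl -lerBlDr; apply: (le_trans L).
  have := @V_pair_bin i j (n%:R / 2) (t - n.+1%:R) (t - n%:R) n.+1%:R.
  rewrite eq_sym ji => /(_ isT x0n); rewrite -[n.+1%:R]natr1 => H.
  have hb : n%:R / 2 <= t - (n%:R + 1) <= t - n%:R by apply/andP; split; lra.
  have hr : n%:R / 2 <= n%:R + 1 :> R by lra.
  have := H hb hr; rewrite -/(bin_mass t n%:R) => /ler_normlP[H' _].
  by move: H'; rewrite /bin -[n.+1%:R]natr1; lra.
apply: (@le_trans _ _ (1 / t + (\sum_i \sum_(N <= n < K)
   ((\sum_(j | j != i) kap i j) * (1 / (n%:R + 1) / t ^+ 2) -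
   (m%:R * g n + m%:R * (m%:R * h n)))) - 4 * m%:R ^+ 2 * M / t ^+ 2)); last first.
  apply: lerB => //; rewrite [leRHS]big_split/=; apply: lerD.
    rewrite -w_sum1 mulr_suml; apply: ler_sum => i _.
    by rewrite V_tail//; lra.
  apply: ler_sum => i _; rewrite big_nat [leRHS]big_nat.
  by apply: ler_sum => n; exact: E4.
have -> : \sum_i \sum_(N <= n < K) ((\sum_(j | j != i) kap i j) * (1 / (n%:R + 1) / t ^+ 2) -
   (m%:R * g n + m%:R * (m%:R * h n))) =
   kapS * ((\sum_(N <= n < K) 1 / (n%:R + 1)) / t ^+ 2) -
   m%:R * (m%:R * \sum_(N <= n < K) g n + m%:R * (m%:R * \sum_(N <= n < K) h n)).
  under eq_bigr do rewrite sumrB/= -!mulr_sumr big_split/= -!mulr_sumr.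
  rewrite sumrB/= -mulr_suml sumr_const card_ord -[_ *+ _]mulr_natl.
  by congr (_ * _ - _); rewrite ?mulr_suml// /h -!mulr_sumr.
have F : kapS * ((ln t - (ln 2 + ln N.+1%:R)) / t ^+ 2) <=
    kapS * ((\sum_(N <= n < K) 1 / (n%:R + 1)) / t ^+ 2).
  apply: ler_wpM2l => //; rewrite ler_wpM2r ?invr_ge0 ?(ltW t20)//.
  apply: le_trans (sum_invS_ge _ NK); rewrite opprD addrA lerB//.
  rewrite -ln_div ?posrE//; rewrite ler_ln ?posrE ?ltr0n//; first by lra.
  by rewrite divr_gt0.
have NK0 : (0 < N)%N by rewrite (leq_trans _ N4).
have s3 := @sum_inv_sqrt_le R N K NK0.
have G : \sum_(N <= n < K) g n = 4 / t ^+ 2 * W N K by rewrite mulr_sumr.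
have H : \sum_(N <= n < K) h n <= 12 * M / t ^+ 2.
  apply: (@le_trans _ _ (4 * M / t ^+ 2 * 3)).
    by rewrite /h -mulr_sumr; apply: ler_wpM2l => //; rewrite !(mulr_ge0, invr_ge0, exprn_ge0)// ltW.
  by rewrite le_eqVlt; apply/orP; left; apply/eqP; field; rewrite gt_eqF.
have GH : m%:R * (m%:R * \sum_(N <= n < K) g n + m%:R * (m%:R * \sum_(N <= n < K) h n))
  <= m%:R * (m%:R * (4 / t ^+ 2 * W N K) + m%:R * (m%:R * (12 * M / t ^+ 2))).
  by rewrite G; do 3!(rewrite ?ler_wpM2l ?lerD ?(ltW m0)//).
apply: (le_trans _ (lerB (lerD (lexx (1 / t)) (lerB F GH)) (lexx _))).
rewrite le_eqVlt; apply/orP; left; apply/eqP; field.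
by rewrite !gt_eqF.
Qed.

(** The sum of the moduli stays explicit in the remainder: it is o(log t) when [om] tends to 0 and
    bounded under the Dini condition, so both expansions follow from this one bound. Its range is
    enlarged from t / 2 to t, which is harmless since the terms are nonnegative. *)
Lemma tail_expansion : exists C t0 : R, exists N : nat,
  [/\ 0 <= C, 1 <= t0, (4 <= N)%N, 2 * x0 <= N%:R & forall t, t0 <= t ->
  `|pr P (fun x => t < S x) - (1 / t + kapS * (ln t / t ^+ 2))| <=
   C / t ^+ 2 * (1 + \sum_(N <= n < Num.truncn t) om (n%:R / 2) / n%:R)].
Proof.
have M0 := M_ge0; have m0 := m_gt0.
have m1 : 1 <= m%:R :> R by rewrite ler1n -(ltr0n R).
have kapS0 : 0 <= kapS.
  by apply: sumr_ge0 => i _; apply: sumr_ge0 => j _; have /andP[] := kap_bound i j.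
pose N := (4 + (Num.truncn (2 * x0)).+1)%N.
have N4 : (4 <= N)%N by rewrite leq_addr.
have x00 : 0 <= x0 by exact: le_trans x0_ge1.
have x0N : 2 * x0 <= N%:R.
  have /andP[_ /ltW h] := truncn_itv (mulr_ge0 (ler0n _ 2) x00).
  by apply: le_trans h _; rewrite ler_nat leq_addl.
have lnN : 0 <= ln 2 + ln N.+1%:R :> R by rewrite addr_ge0// ln_ge0// ?ler1n//; lra.
have a1 : 0 <= m%:R ^+ 4 * M by rewrite mulr_ge0// exprn_ge0// ltW.
have a2 : 0 <= m%:R ^+ 2 * M by rewrite mulr_ge0// exprn_ge0// ltW.
have a3 : 0 <= m%:R ^+ 3 * M by rewrite mulr_ge0// exprn_ge0// ltW.
have a4 : 0 <= m%:R ^+ 5 * M by rewrite mulr_ge0// exprn_ge0// ltW.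
have a5 : 0 <= m%:R ^+ 2 :> R by rewrite exprn_ge0// ltW.
have a6 := mulr_ge0 kapS0 lnN.
have a7 : 0 <= N%:R :> R by [].
exists (C N 0 + 8 * m%:R ^+ 2 + kapS * (ln 2 + ln N.+1%:R) + 12 * m%:R ^+ 3 * M +
   4 * m%:R ^+ 2 * M).
exists (2 * N%:R + 2 * x0 * m%:R + 1), N; split => //.
- by rewrite /C; lra.
- by rewrite lerDr addr_ge0// !mulr_ge0.
move=> t tt0.
have Nx0 : 0 <= 2 * N%:R :> R by rewrite mulr_ge0.
have x0m : 0 <= 2 * x0 * m%:R by rewrite !mulr_ge0.
have t0 : 0 < t by lra.
pose K := Num.truncn (t / 2).
have tK : K%:R <= t / 2 < K.+1%:R by apply: truncn_itv; lra.
have om0 n : (N <= n)%N -> 0 <= om (n%:R / 2) / n%:R.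
  move=> Nn; rewrite divr_ge0// om_ge0//.
  by have : N%:R <= n%:R :> R by [rewrite ler_nat]; lra.
have WK : W N K <= \sum_(N <= n < Num.truncn t) om (n%:R / 2) / n%:R.
  have Kt : (K <= Num.truncn t)%N by apply: le_truncn; lra.
  have NK : (N <= K)%N by rewrite -ltnS -(ltr_nat R); case/andP: tK; lra.
  rewrite [leRHS](big_cat_nat NK Kt)/= -[leLHS]addr0 lerD//.
  rewrite big_nat; apply: sumr_ge0 => n /andP[Kn _]; apply: om0; exact: leq_trans Kn.
have W0 : 0 <= W N K by rewrite /W big_nat; apply: sumr_ge0 => n /andP[Nn _]; exact: om0.
have [U L] : _ /\ _ := conj (@tail_upper_bound t N K N4 x0N ltac:(lra) ltac:(lra) tK)
  (@tail_lower_bound t N K N4 x0N ltac:(lra) ltac:(lra) tK).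
set W' := \sum_(N <= n < _) _ in WK *; set p := pr P _ in U L *.
have t20 : 0 < (t ^+ 2)^-1 by rewrite invr_gt0 exprn_gt0.
set C' := (X in X / t ^+ 2 * _).
have := erefl C'; rewrite {2}/C' {1}/C; move: @C' => C' C'E.
have C'0 : 8 * m%:R ^+ 2 <= C' by lra.
have CW : 8 * m%:R ^+ 2 * W N K <= C' * W' by apply: ler_pM => //; lra.
have W5 := mulr_ge0 a5 W0.
have hU : C N (W N K) <= C' * (1 + W').
  by rewrite mulrDr mulr1 /C; lra.
have hL : kapS * (ln 2 + ln N.+1%:R) + 4 * m%:R ^+ 2 * W N K
     + 12 * m%:R ^+ 3 * M + 4 * m%:R ^+ 2 * M <= C' * (1 + W').
  by lra.
have hU' := ler_wpM2r (ltW t20) hU; have hL' := ler_wpM2r (ltW t20) hL.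
by rewrite [leRHS]mulrAC ler_norml; apply/andP; split; lra.
Qed.

End tail_expansion.

(** * Box probabilities from the marginal densities *)

Section marginal_densities.
Context (R : realType).
Local Notation RT := (measurableTypeR R).

Lemma measurable_box (n : nat) (A : 'I_n -> set RT) :
  (forall k, measurable (A k)) ->
  measurable [set u : n.-tuple RT | forall k, A k (tnth u k)].
Proof.
move=> mA; rewrite (_ : mkset _ = \bigcap_(k in [set: 'I_n])
    ((fun u => tnth u k) @^-1` A k)).
  apply: fin_bigcap_measurable => // k _; rewrite -[X in measurable X]setTI.
  exact: measurable_tnth.
by apply/seteqP; split => [u h k _|u h k]; exact: h.
Qed.

Lemma measurable_open_cube (n : nat) : measurable (@open_cube R n).
Proof.
rewrite (_ : @open_cube R n =
    [set u : n.-tuple RT | forall k, `]0%R, 1%R[%classic (tnth u k)]).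
  by apply: (@measurable_box n (fun=> `]0%R, 1%R[%classic)) => k; exact: measurable_itv.
by apply/seteqP; split => u h k; have := h k; rewrite /= in_itv.
Qed.

Context (d : measure_display) (T : measurableType d) (P : probability T R)
  (m : nat) (U : 'I_m -> T -> R).
Context (I : {set 'I_m}) (f : #|I|.-tuple RT -> R).
Context (fU : is_marginal_density P U f).

Lemma prob_boxE (A : 'I_m -> set RT) : (forall i, measurable (A i)) ->
  P [set x | forall i, i \in I -> A i (U i x)] =
  (\int[lebesgue_tuple R #|I|]_(u in
     [set u | forall k, A (enum_val k) (tnth u k)] `&` @open_cube R #|I|)
     (f u)%:E)%E.
Proof.
move=> mA; have [_ _ <-] := fU; last first.
  exact: (measurable_box (fun k => mA (enum_val k))).
congr (P _); apply/seteqP; split => x /= h.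
  by move=> k; rewrite tnth_mktuple; apply: h; exact: enum_valP.
move=> i iI; have := h (enum_rank_in iI i).
by rewrite tnth_mktuple enum_rankK_in.
Qed.

Lemma lebesgue_boxE (A : 'I_m -> set RT) : (forall i, measurable (A i)) ->
  lebesgue_tuple R #|I| [set u | forall k, A (enum_val k) (tnth u k)] =
  (\prod_(i in I) lebesgue_measure (A i))%E.
Proof.
move=> mA; rewrite big_enum_val.
exact: (lebesgue_tuple_box (A := fun k => A (enum_val k))).
Qed.

Lemma prob_box_le (A : 'I_m -> set RT) (B : R) : 0 <= B ->
  (forall i, measurable (A i)) ->
  (\forall u \ae lebesgue_tuple R #|I|,
     (forall k, A (enum_val k) (tnth u k)) -> open_cube u -> f u <= B) ->
  (P [set x | forall i, i \in I -> A i (U i x)] <=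
   B%:E * \prod_(i in I) lebesgue_measure (A i))%E.
Proof.
move=> B0 mA fB; have [mf f0 _] := fU; rewrite prob_boxE//.
set D := (X in X `&` _).
have mD : measurable D by exact: (measurable_box (fun k => mA (enum_val k))).
have mDC : measurable (D `&` @open_cube R #|I|).
  by apply: measurableI => //; exact: measurable_open_cube.
apply: (@le_trans _ _ (\int[lebesgue_tuple R #|I|]_(u in D `&` @open_cube R #|I|) cst B%:E u)%E).
  apply: ae_ge0_le_integral => //.
  - by move=> u [_ /f0]; rewrite lee_fin.
  - apply/measurable_EFinP; apply: measurable_funS mf => //.
    exact: measurable_open_cube.
  - by apply: filterS fB => u h [Du Cu]; rewrite lee_fin; exact: h.
rewrite integral_cst// lee_wpmul2l// -lebesgue_boxE//; apply: le_measure => //;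
  by rewrite ?inE.
Qed.

Lemma prob_box_ge (A : 'I_m -> set RT) (B : R) :
  (forall i, measurable (A i)) -> (forall i, i \in I -> A i `<=` `]0%R, 1%R[) ->
  (\forall u \ae lebesgue_tuple R #|I|,
     (forall k, A (enum_val k) (tnth u k)) -> open_cube u -> B <= f u) ->
  (B%:E * \prod_(i in I) lebesgue_measure (A i) <=
   P [set x | forall i, i \in I -> A i (U i x)])%E.
Proof.
(* A negative [B] arises when the modulus exceeds the corner limit; the bound is then trivial. *)
move=> mA A01 fB; have [B0|/ltW B0] := leP 0 B; last first.
  apply: (@le_trans _ _ 0%E) => //.
  by apply: mule_le0_ge0; rewrite ?lee_fin// prode_ge0.
have [mf f0 _] := fU; rewrite prob_boxE//.
set D := (X in X `&` _).
have mD : measurable D by exact: (measurable_box (fun k => mA (enum_val k))).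
have mDC : measurable (D `&` @open_cube R #|I|).
  by apply: measurableI => //; exact: measurable_open_cube.
have DC : D `&` @open_cube R #|I| = D.
  apply: setIidl => u Du k; have := A01 _ (enum_valP k) _ (Du k).
  by rewrite /= in_itv.
rewrite -lebesgue_boxE// -/D -{1}DC.
rewrite -integral_cst//; apply: ae_ge0_le_integral => //.
- by move=> u [_ /f0]; rewrite lee_fin.
- apply/measurable_EFinP; apply: measurable_funS mf => //.
    exact: measurable_open_cube.
- by apply: filterS fB => u h [Du Cu]; rewrite lee_fin; exact: h.
Qed.

Lemma ess_sup_on_le d' (X : measurableType d') (mu : {measure set X -> \bar R})
    (A : set X) (g : X -> R) (y : R) :
  (ess_sup_on mu A g <= y%:E)%E <-> \forall x \ae mu, A x -> g x <= y.
Proof.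
split.
  move/ess_supP; apply: filterS => x + Ax.
  by rewrite /patch mem_set// lee_fin.
move=> h; apply/ess_supP; apply: filterS h => x h; rewrite /patch.
by case: ifPn => [/set_mem/h|_]; rewrite ?lee_fin// leNye.
Qed.

Lemma ess_inf_on_ge d' (X : measurableType d') (mu : {measure set X -> \bar R})
    (A : set X) (g : X -> R) (y : R) :
  (y%:E <= ess_inf_on mu A g)%E <-> \forall x \ae mu, A x -> y <= g x.
Proof.
split.
  move/ess_infP; apply: filterS => x + Ax.
  by rewrite /patch mem_set// lee_fin.
move=> h; apply/ess_infP; apply: filterS h => x h; rewrite /patch.
by case: ifPn => [/set_mem/h|_]; rewrite ?lee_fin// leey.
Qed.

(** One edge below u0 puts the whole box, within the cube, into the region where the density is
    essentially bounded; the other edges are arbitrary. *)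
Lemma prob_box_le_ess_sup (u0 M : R) (A : 'I_m -> set RT) (i : 'I_m) : 0 <= M ->
  (ess_sup_on (lebesgue_tuple R #|I|) (lower_boundary u0) f <= M%:E)%E ->
  (forall i, measurable (A i)) -> i \in I -> A i `<=` [set u | u <= u0] ->
  (P [set x | forall i, i \in I -> A i (U i x)] <=
   M%:E * \prod_(i in I) lebesgue_measure (A i))%E.
Proof.
move=> M0 /ess_sup_on_le fM mA iI Ai; apply: prob_box_le => //.
apply: filterS fM => u h Au uC; apply: h; split => //.
apply: (le_trans (bigmin_le _ (enum_rank_in iI i) _)); apply: Ai.
by have := Au (enum_rank_in iI i); rewrite enum_rankK_in.
Qed.

End marginal_densities.

(** * Identification of pairs with tuples indexed by {i, j} *)

Section pair_densities.
Context (R : realType).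
Local Notation RT := (measurableTypeR R).
Local Notation leb2 := (lebesgue_measure \x lebesgue_measure)%E.
Context (m : nat) (c : forall I : {set 'I_m}, #|I|.-tuple RT -> R) (i j : 'I_m).
Context (ij : i != j).
Local Notation I := [set i; j]%SET.

Definition pair_to_tuple (p : RT * RT) : #|I|.-tuple RT :=
  [tuple if enum_val k == i then p.1 else p.2 | k < #|I|].

Let iI : i \in I. Proof. by rewrite !inE eqxx. Qed.
Let jI : j \in I. Proof. by rewrite !inE eqxx orbT. Qed.

(** Coordinates are located by rank, because the order in which the enumeration lists i and j is not
    known. *)
Definition tuple_to_pair (u : #|I|.-tuple RT) : RT * RT :=
  (tnth u (enum_rank_in iI i), tnth u (enum_rank_in jI j)).

Lemma tuple_to_pairK : cancel tuple_to_pair pair_to_tuple.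
Proof.
move=> u; apply: eq_from_tnth => k; rewrite tnth_mktuple /=.
have := enum_valP k; rewrite !inE => /orP[|] /eqP kE.
  rewrite kE eqxx; congr tnth; apply: enum_val_inj.
  by rewrite enum_rankK_in.
rewrite kE eq_sym (negbTE ij); congr tnth; apply: enum_val_inj.
by rewrite enum_rankK_in.
Qed.

Lemma measurable_pair_to_tuple : measurable_fun setT pair_to_tuple.
Proof.
apply/measurable_fun_tnthP => k.
rewrite (_ : _ \o _ = fun p : RT * RT => if enum_val k == i then p.1 else p.2).
  by case: (enum_val k == i); [exact: measurable_fst|exact: measurable_snd].
by apply/funext => p /=; rewrite tnth_mktuple.
Qed.

Lemma measurable_tuple_to_pair : measurable_fun setT tuple_to_pair.
Proof. by apply/measurable_fun_pairP; split; exact: measurable_tnth. Qed.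

Let mB (X : set (RT * RT)) : measurable X -> measurable (tuple_to_pair @^-1` X).
Proof. by move=> mX; rewrite -[X in measurable X]setTI; exact: measurable_tuple_to_pair. Qed.

(** By uniqueness of the product measure it suffices to compare rectangles, whose preimages are
    boxes. *)
Lemma lebesgue_pairE (X : set (RT * RT)) : measurable X ->
  leb2 X = lebesgue_tuple R #|I| (tuple_to_pair @^-1` X).
Proof.
move=> mX; have mT := measurable_tuple_to_pair.
apply: (@product_measure_unique _ _ _ _ _ _ _
  (pushforward (lebesgue_tuple R #|I|) tuple_to_pair)) => // A B mA mB'.
pose D (k : 'I_m) := if k == i then A else B.
have E : tuple_to_pair @^-1` (A `*` B) = [set u | forall k, D (enum_val k) (tnth u k)].
  apply/seteqP; split => u /=.
    move=> [Au Bu] k; have := enum_valP k; rewrite !inE => /orP[|] /eqP kE.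
      rewrite /D kE eqxx; suff -> : k = enum_rank_in iI i by [].
      by apply: enum_val_inj; rewrite enum_rankK_in.
    rewrite /D kE eq_sym (negbTE ij); suff -> : k = enum_rank_in jI j by [].
    by apply: enum_val_inj; rewrite enum_rankK_in.
  move=> h; split => /=.
    by have := h (enum_rank_in iI i); rewrite enum_rankK_in// /D eqxx.
  by have := h (enum_rank_in jI j); rewrite enum_rankK_in// /D eq_sym (negbTE ij).
rewrite /= /pushforward E lebesgue_boxE => [|k]; last by rewrite /D; case: ifP.
rewrite big_setU1 ?inE//= big_set1 /D eqxx.
by rewrite eq_sym (negbTE ij).
Qed.

(** The density bounds live on tuples, the corner limits and moduli on pairs; null sets have to be
    carried both ways. *)
Lemma ae_tuple_of_pair (Q : RT * RT -> Prop) :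
  (\forall p \ae leb2, Q p) -> \forall u \ae lebesgue_tuple R #|I|, Q (tuple_to_pair u).
Proof.
move=> [N [mN N0 QN]]; exists (tuple_to_pair @^-1` N); split; first exact: mB.
  by rewrite -lebesgue_pairE.
by move=> u /= /QN.
Qed.

Lemma ae_pair_of_tuple (Q : #|I|.-tuple RT -> Prop) :
  (\forall u \ae lebesgue_tuple R #|I|, Q u) -> \forall p \ae leb2, Q (pair_to_tuple p).
Proof.
move=> [N [mN N0 QN]]; exists (pair_to_tuple @^-1` N).
have mN' : measurable (pair_to_tuple @^-1` N).
  by rewrite -[X in measurable X]setTI; exact: measurable_pair_to_tuple.
split => //; last by move=> p /= /QN.
rewrite lebesgue_pairE// -comp_preimage (_ : _ \o _ = id) ?preimage_id//.
by apply/funext => u /=; rewrite tuple_to_pairK.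
Qed.

Lemma pair_densityE (p : RT * RT) : pair_density c i j p = c (pair_to_tuple p).
Proof. by []. Qed.

Lemma pair_to_tuple_cube (p : RT * RT) : 0 < p.1 < 1 -> 0 < p.2 < 1 ->
  open_cube (pair_to_tuple p).
Proof. by move=> p1 p2 k; rewrite tnth_mktuple; case: ifP. Qed.

End pair_densities.

(** * The corner modulus and pair boxes near the origin *)

Section corner_modulus.
Context (R : realType).
Local Notation RT := (measurableTypeR R).
Local Notation leb2 := (lebesgue_measure \x lebesgue_measure)%E.

Lemma lebesgue_corner (s : R) : 0 < s -> leb2 (corner s) = (s * s)%:E.
Proof.
move=> s0; rewrite (_ : corner s = `]0%R, s] `*` `]0%R, s]); last first.
  by apply/seteqP; split => p; rewrite /corner/= !in_itv/= => -[].
by rewrite product_measure1E//= lebesgue_measure_itv/= lte_fin s0 sube0.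
Qed.

(** The corner has positive area s^2, so the essential supremum really sees the nonnegative values
    on it; over a null set it would be -oo. *)
Lemma omega_ge0 (f : RT * RT -> R) (l s : R) : 0 < s -> (0 <= omega f l s)%E.
Proof.
move=> s0; rewrite leNgt; apply/negP => h.
have mc : measurable (corner s : set (RT * RT)).
  rewrite (_ : corner s = `]0%R, s] `*` `]0%R, s]); first exact: measurableX.
  by apply/seteqP; split => p; rewrite /corner/= !in_itv/= => -[].
have : leb2.-negligible (corner s).
  have [N [mN N0 hN]] := @ess_sup_ge _ _ _ leb2 (patch (cst -oo%E) (corner s) (EFin \o (fun p => `|f p - l|))).
  exists N; split => // p sp; apply: hN => /=; apply/negP; rewrite -ltNge.
  by apply: (lt_le_trans h); rewrite /patch mem_set// lee_fin.
move/(measure_negligible mc)/(etrans (esym (lebesgue_corner s0)))/eqP.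
by rewrite eqe mulf_eq0 orbb gt_eqF.
Qed.

Lemma le_omega (f : RT * RT -> R) (l s s' : R) : s <= s' ->
  (omega f l s <= omega f l s')%E.
Proof.
move=> ss'; apply: le_ess_sup; apply: nearW => p; rewrite /patch.
case: ifPn => [/set_mem[p1 p2]|_]; last by rewrite leNye.
rewrite mem_set//; case/andP: p1 => ? ?; case/andP: p2 => ? ?.
by split; apply/andP; split; lra.
Qed.

Context (d : measure_display) (T : measurableType d) (P : probability T R)
  (m : nat) (U : 'I_m -> {RV P >-> R})
  (c : forall I : {set 'I_m}, #|I|.-tuple RT -> R) (i j : 'I_m) (ij : i != j)
  (cU : is_marginal_density P U (@c [set i; j]%SET))
  (u0 M l : R) (u0_itv : 0 < u0 < 1) (M_ge0 : 0 <= M)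
  (c_le : (ess_sup_on (lebesgue_tuple R #|[set i; j]%SET|)
            (lower_boundary u0) (@c [set i; j]%SET) <= M%:E)%E)
  (l_sup : ess_sup_on leb2 (corner s) (pair_density c i j) @[s --> 0^'+] --> l%:E)
  (l_inf : ess_inf_on leb2 (corner s) (pair_density c i j) @[s --> 0^'+] --> l%:E).

Lemma pair_density_ge0 (p : RT * RT) : 0 < p.1 < 1 -> 0 < p.2 < 1 ->
  0 <= pair_density c i j p.
Proof.
move=> p1 p2; have [_ c0 _] := cU; apply: c0.
by apply: pair_to_tuple_cube.
Qed.

Lemma pair_density_le (s : R) : s <= u0 ->
  \forall p \ae leb2, corner s p -> 0 <= pair_density c i j p <= M.
Proof.
move=> su0; have /andP[u00 u01] := u0_itv.
have /(ae_pair_of_tuple ij) := (ess_sup_on_le _ _ _ _).1 c_le.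
apply: filterS => p h [/andP[p10 p1s] /andP[p20 p2s]].
have p1 : 0 < p.1 < 1 by apply/andP; split => //; lra.
have p2 : 0 < p.2 < 1 by apply/andP; split => //; lra.
rewrite pair_density_ge0//=; apply: h; split; first exact: pair_to_tuple_cube.
have iI : i \in [set i; j]%SET by rewrite !inE eqxx.
apply: (le_trans (bigmin_le _ (enum_rank_in iI i) _)).
by rewrite tnth_mktuple enum_rankK_in// eqxx; lra.
Qed.

Lemma omega_le (s : R) : s <= u0 ->
  (omega (pair_density c i j) l s <= (M + `|l|)%:E)%E.
Proof.
move=> su0; apply/ess_sup_on_le; apply: filterS (pair_density_le su0) => p h /h.
move=> /andP[h0 hM]; apply: (le_trans (ler_normB _ _)).
by rewrite lerD2r ger0_norm.
Qed.

Lemma omega_fin (s : R) : 0 < s <= u0 ->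
  omega (pair_density c i j) l s = (fine (omega (pair_density c i j) l s))%:E.
Proof.
move=> /andP[s0 su0]; rewrite fineK// ge0_fin_numE ?omega_ge0//.
by apply: (le_lt_trans (omega_le su0)); rewrite ltry.
Qed.

Lemma omega_near0 (e : R) : 0 < e ->
  \forall s \near 0^'+, (omega (pair_density c i j) l s <= e%:E)%E.
Proof.
move=> e0.
have h1 : \forall s \near 0^'+,
   (ess_sup_on leb2 (corner s) (pair_density c i j) < (l + e)%:E)%E.
  have hl : (l%:E < (l + e)%:E)%E by rewrite lte_fin; lra.
  exact: (l_sup (open_ereal_lt' hl)).
have h2 : \forall s \near 0^'+,
   ((l - e)%:E < ess_inf_on leb2 (corner s) (pair_density c i j))%E.
  have hl : ((l - e)%:E < l%:E)%E by rewrite lte_fin; lra.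
  exact: (l_inf (open_ereal_gt' hl)).
near=> s; apply/ess_sup_on_le.
have /ess_sup_on_le : (ess_sup_on leb2 (corner s) (pair_density c i j) <= (l + e)%:E)%E.
  by apply/ltW; near: s.
have /ess_inf_on_ge : ((l - e)%:E <= ess_inf_on leb2 (corner s) (pair_density c i j))%E.
  by apply/ltW; near: s.
apply: filterS2 => p a1 a2 sp; have := a1 sp; have := a2 sp.
by move=> ? ?; rewrite ler_distlC; apply/andP; split; lra.
Unshelve. all: by end_near. Qed.

Lemma corner_limit_ge0 : 0 <= l.
Proof.
rewrite leNgt; apply/negP => l0.
have h1 : \forall s \near 0^'+,
   (ess_inf_on leb2 (corner s) (pair_density c i j) < 0%:E)%E.
  have hl : (l%:E < 0%:E)%E by rewrite lte_fin.
  exact: (l_inf (open_ereal_lt' hl)).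
have h2 : \forall s \near (0 : R)^'+, s < 1 by apply: nbhs_right_lt.
have [s [/= + s1]] := @filter_ex _ _ (at_right_proper_filter (0 : R)) _ (filterI h1 h2).
apply/negP; rewrite -leNgt; apply/ess_inf_on_ge; apply: nearW => p.
move=> [/andP[p10 p1s] /andP[p20 p2s]].
by apply: pair_density_ge0; apply/andP; split => //; lra.
Qed.

(** Almost everywhere on the product of [A] and [B], which lies in the corner of side s, the density
    differs from l by at most the modulus at s; the box has area a b. *)
Lemma prob_pair_bin (A B : set RT) (a b s : R) : 0 < s <= u0 ->
  measurable A -> measurable B -> A `<=` `]0%R, s] -> B `<=` `]0%R, s] ->
  lebesgue_measure A = a%:E -> lebesgue_measure B = b%:E ->
  `|fine (P [set x | A (U i x) /\ B (U j x)]) - l * a * b| <=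
  fine (omega (pair_density c i j) l s) * a * b.
Proof.
move=> s0u0 mA mB As Bs Aa Bb; have := s0u0 => /andP[s0 su0].
have /andP[u00 u01] := u0_itv.
pose D k := if k == i then A else B.
have mD k : measurable (D k) by rewrite /D; case: ifP.
have DE : [set x | A (U i x) /\ B (U j x)] =
   [set x | forall k, k \in [set i; j]%SET -> D k (U k x)].
  apply/seteqP; split => x /=.
    move=> [Ax Bx] k; rewrite !inE /D => /orP[|] /eqP ->; first by rewrite eqxx.
    by rewrite eq_sym (negbTE ij).
  move=> h; split; first by have := h i; rewrite !inE /D eqxx; apply.
  by have := h j; rewrite !inE /D eqxx orbT eq_sym (negbTE ij); apply.
have lD : (\prod_(k in [set i; j]%SET) lebesgue_measure (D k) = (a * b)%:E)%E.
  rewrite big_setU1 ?inE//= big_set1 /D eqxx.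
  by rewrite eq_sym (negbTE ij) Aa Bb.
have [W W0 WE] : exists2 W, 0 <= W & omega (pair_density c i j) l s = W%:E.
  exists (fine (omega (pair_density c i j) l s)); last exact: omega_fin.
  by rewrite fine_ge0// omega_ge0.
have hW : \forall u \ae lebesgue_tuple R #|[set i; j]%SET|,
   (forall k, D (enum_val k) (tnth u k)) -> `|c u - l| <= W.
  have /ess_sup_on_le/(ae_tuple_of_pair ij) : (omega (pair_density c i j) l s <= W%:E)%E.
    by rewrite WE.
  apply: filterS => u; cbv beta; rewrite pair_densityE (tuple_to_pairK ij) => h Du; apply: h.
  split; rewrite /tuple_to_pair/=; set k := enum_rank_in _ _; have := Du k;
    rewrite /k enum_rankK_in ?inE ?eqxx ?orbT// /D ?eqxx.
    by move/As; rewrite /= in_itv.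
  by rewrite eq_sym (negbTE ij) => /Bs; rewrite /= in_itv.
have mE : measurable [set x | A (U i x) /\ B (U j x)].
  apply: measurableI.
    by rewrite -[X in measurable X]setTI; exact: (measurable_funP (U i)).
  by rewrite -[X in measurable X]setTI; exact: (measurable_funP (U j)).
have [p pE] : exists p, P [set x | A (U i x) /\ B (U j x)] = p%:E.
  by exists (fine (P [set x | A (U i x) /\ B (U j x)])); rewrite fineK// fin_num_measure.
rewrite WE/= ler_norml.
have up : (P [set x | A (U i x) /\ B (U j x)] <= (l + W)%:E * (a * b)%:E)%E.
  rewrite DE -lD; apply: (prob_box_le cU) => //.
    by rewrite addr_ge0// corner_limit_ge0.
  apply: filterS hW => u h Du _; have := h Du.
  by rewrite ler_distl => /andP[_].
have lo : ((l - W)%:E * (a * b)%:E <= P [set x | A (U i x) /\ B (U j x)])%E.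
  rewrite DE -lD; apply: (prob_box_ge cU) => //.
    move=> k _; rewrite /D; case: ifP => _ x; [move/As|move/Bs];
    by rewrite /= !in_itv/= => /andP[-> /=]; lra.
  apply: filterS hW => u h Du _; have := h Du.
  by rewrite ler_distl => /andP[].
by move: up lo; rewrite pE -!EFinM !lee_fin /=; lra.
Qed.

End corner_modulus.

(** * The Dini integral *)

Section integral_comparison.
Context (R : realType).
Local Notation mu := (@lebesgue_measure R).

(* Unlike [ge0_le_integral], no measurability is asked of the integrands. *)
Lemma nonmeasurable_le_integral (D : set R) (f g : R -> \bar R) :
  (forall x, D x -> 0 <= f x)%E -> (forall x, D x -> f x <= g x)%E ->
  (\int[mu]_(x in D) f x <= \int[mu]_(x in D) g x)%E.
Proof.
move=> f0 fg; have g0 x : D x -> (0 <= g x)%E.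
  by move=> Dx; apply: (le_trans (f0 x Dx)); exact: fg.
rewrite !ge0_integralE//; apply: ge_ereal_sup => _ [h/= hf] <-.
apply: ereal_sup_ubound; exists h => // x; apply: (le_trans (hf x)).
by rewrite /patch; case: ifPn => // /set_mem; exact: fg.
Qed.

(* On the cell [2 / n, 2 / (n - 1)[ the integrand is at least g (2 / n) (n - 1) / 2,
   and this constant integrates to g (2 / n) / n over the cell. *)
Lemma sum_le_integral (g : R -> \bar R) (u0 : R) (B : R) :
  (forall s, 0 < s <= u0 -> (0 <= g s)%E /\ g s = (fine (g s))%:E) ->
  (forall s s', s <= s' -> (g s <= g s')%E) ->
  (\int[mu]_(s in `]0%R, u0[) (g s * (s^-1)%:E) <= B%:E)%E ->
  forall N K : nat, (1 < N)%N -> 2 / N.-1%:R < u0 ->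
  \sum_(N <= n < K) fine (g (2 / n%:R)) / n%:R <= B.
Proof.
move=> gfin gmono gB N K N1 Nu0; rewrite -lee_fin; apply: le_trans gB.
pose itv (n : nat) : set R := `[2 / n%:R, 2 / n.-1%:R[%classic.
(* The value 0 below [N] makes [h] nonnegative at every index, as the exchange of sum and integral
   requires. *)
pose h (n : nat) := if (N <= n)%N then fine (g (2 / n%:R)) * (n.-1%:R / 2) else 0.
have mitv n : measurable (itv n) by exact: measurable_itv.
have N0 : (0 < N.-1)%N by rewrite -ltnS prednK// ltnW.
have nfacts (n : nat) : (N <= n)%N -> [/\ 0 < n.-1%:R :> R, n%:R = n.-1%:R + 1 :> R
    & 2 / n.-1%:R < u0].
  move=> Nn; have n1 : (N.-1 <= n.-1)%N by rewrite -!subn1 leq_sub2r.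
  have n10 : (0 < n.-1%:R :> R) by rewrite ltr0n (leq_trans N0).
  split => //; first by rewrite natr1 prednK// (leq_trans _ Nn)// ltnW.
  apply: le_lt_trans Nu0; rewrite ler_pM2l// lef_pV2 ?posrE ?ltr0n// ?ler_nat//.
  exact: leq_trans N0 n1.
have hfacts (n : nat) : (N <= n)%N -> [/\ 0 < 2 / n%:R :> R, 2 / n%:R < 2 / n.-1%:R :> R,
   (0 <= g (2 / n%:R)%R)%E & g (2 / n%:R) = (fine (g (2 / n%:R)))%:E].
  move=> /nfacts[n1 nE nu].
  have n0 : 0 < n%:R :> R by lra.
  have lt : 2 / n%:R < 2 / n.-1%:R :> R by rewrite ltr_pM2l// ltf_pV2 ?posrE//; lra.
  have p0 : 0 < 2 / n%:R :> R by rewrite divr_gt0.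
  by have [|? ?] := gfin (2 / n%:R); first by rewrite p0/=; lra.
have h0 (n : nat) : 0 <= h n.
  rewrite /h; case: ifPn => // Nn; have [_ _ g0 _] := hfacts n Nn.
  by rewrite mulr_ge0 ?fine_ge0// divr_ge0.
have -> : (\sum_(N <= n < K) fine (g (2 / n%:R)) / n%:R)%:E =
  (\int[mu]_(s in `]0%R, u0[) (\sum_(N <= n < K) (h n)%:E * (\1_(itv n) s)%:E))%E.
  rewrite ge0_integral_sum//; last 2 first.
  - move=> n; apply/measurable_EFinP; apply: measurable_funM => //.
    exact: (measurable_indic (mitv n)).
  - by move=> n s _; rewrite -EFinM lee_fin mulr_ge0.
  rewrite -sumEFin big_nat [RHS]big_nat; apply: eq_bigr => n /andP[Nn _].
  have [p0 lt gn0 gnE] := hfacts n Nn; have [n1 nE nu] := nfacts n Nn.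
  rewrite ge0_integralZl_EFin//; last first.
    by apply/measurable_EFinP; exact: (measurable_indic (mitv n)).
  rewrite integral_indic//; last exact: mitv.
  have E : itv n = itv n `&` `]0%R, u0[.
    apply/esym/setIidl => s; rewrite /itv/= !in_itv/= => /andP[s1 s2].
    by apply/andP; split; lra.
  transitivity ((h n)%:E * mu (itv n))%E; last by rewrite {1}E.
  rewrite lebesgue_measure_itv/= lte_fin lt -EFinD -EFinM /h Nn; congr EFin.
  by rewrite nE; field; apply/andP; split; apply/eqP; lra.
refine (@nonmeasurable_le_integral _ _ _ _ _) => s /=; rewrite in_itv/= => /andP[s0 su0].
  by apply: sume_ge0 => n _; rewrite -EFinM lee_fin mulr_ge0.
have [gs0 gsE] : (0 <= g s)%E /\ g s = (fine (g s))%:E.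
  by apply: gfin; rewrite s0 ltW.
rewrite (eq_bigr (fun n => (h n * \1_(itv n) s)%:E)) => [|n _]; last by rewrite EFinM.
rewrite sumEFin gsE -EFinM lee_fin.
have gs0' : 0 <= fine (g s) by rewrite fine_ge0.
have [[n [Nn _] sn]|none] := pselect (exists2 n, (N <= n)%N /\ true & itv n s).
  have [n1 nE nu] := nfacts n Nn.
  have n0 : 0 < n%:R :> R by lra.
  have [p0 lt gn0 gnE] := hfacts n Nn.
  have /andP[sn1 sn2] : 2 / n%:R <= s < 2 / n.-1%:R by move: sn; rewrite /itv/= in_itv.
  apply: (@ler_sum_single _ _ _ _ n); rewrite ?iota_uniq//.
  - by rewrite mulr_ge0// invr_ge0 ltW.
  - rewrite indicE mem_set// mulr1 /h Nn; apply: ler_pM.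
    + by rewrite fine_ge0.
    + by rewrite divr_ge0// ltW.
    + by rewrite -lee_fin -gnE -gsE; exact: gmono.
    + rewrite -[leLHS]invrK lef_pV2 ?posrE ?invr_gt0//; last by rewrite divr_gt0.
      by rewrite invf_div ltW.
  - move=> n'; rewrite mem_index_iota => /andP[Nn' _] n'n.
    rewrite indicE memNset ?mulr0// => sn'; move/eqP: n'n; apply.
    have [n1' nE' _] := nfacts n' Nn'.
    have n0' : 0 < n'%:R :> R by lra.
    have /andP[sn1' sn2'] : 2 / n'%:R <= s < 2 / n'.-1%:R by move: sn'; rewrite /itv/= in_itv.
    move: sn1 sn2 sn1' sn2'; rewrite !ler_pdivrMr// !ltr_pdivlMr// => a1 a2 a3 a4.
    (* A point s common to two cells gives s (n - 1) < 2 <= s n', and symmetrically, so n = n': the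
       cells are disjoint. *)
    have b1 : n.-1%:R < n'%:R :> R by rewrite -(ltr_pM2l s0); lra.
    have b2 : n'.-1%:R < n%:R :> R by rewrite -(ltr_pM2l s0); lra.
    move: b1 b2; rewrite !ltr_nat => b1 b2.
    have np : (0 < n)%N by rewrite -(ltr0n R).
    have np' : (0 < n')%N by rewrite -(ltr0n R).
    apply/eqP; rewrite eqn_leq; apply/andP; split.
      by rewrite -(prednK np'); exact: b2.
    by rewrite -(prednK np); exact: b1.
rewrite big_nat big1 => [|n /andP[Nn _]]; first by rewrite mulr_ge0// invr_ge0 ltW.
by rewrite indicE memNset ?mulr0// => sn; apply: none; exists n.
Qed.

(** For eta < 1 the integrand is singular at 0, so the fundamental theorem is applied on
    [u0 / (n + 2), u0] and followed by a monotone limit. The shift by 2 keeps the left end strictly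
    below u0 already at n = 0. *)
Lemma integral_powR_lt_pinfty (u0 eta : R) : 0 < u0 -> 0 < eta ->
  (\int[mu]_(s in `]0%R, u0[) (s `^ (eta - 1))%:E < +oo)%E.
Proof.
move=> u00 eta0; pose F (n : nat) : set R := `[u0 / n.+2%:R, u0]%classic.
have an (n : nat) : 0 < u0 / n.+2%:R < u0.
  by rewrite divr_gt0//= ltr_pdivrMr// ltr_pMr// ltr1n.
have Fbig : \bigcup_n F n = `]0%R, u0]%classic.
  apply/seteqP; split => s /=.
    move=> [n _]; rewrite /F/= !in_itv/= => /andP[ns ->]; rewrite andbT.
    by apply: lt_le_trans ns; case/andP: (an n).
  rewrite in_itv/= => /andP[s0 su0]; exists (Num.truncn (u0 / s)) => //.
  rewrite /F/= in_itv/= su0 andbT ler_pdivrMr// -ler_pdivrMl// mulrC.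
  have /andP[_ /ltW h] := truncn_itv (ltW (divr_gt0 u00 s0)).
  by apply: (le_trans h); rewrite ler_nat.
have mp (D : set R) : measurable D -> measurable_fun D (fun s : R => (s `^ (eta - 1))%:E).
  by move=> mD; apply/measurable_EFinP; apply: measurable_funTS; exact: measurable_powR.
apply: (@le_lt_trans _ _ (\int[mu]_(s in \bigcup_n F n) (s `^ (eta - 1))%:E)%E).
  rewrite Fbig; apply: ge0_subset_integral => //; first exact: mp.
    by move=> s _; rewrite lee_fin powR_ge0.
  by apply: subset_itvl; rewrite bnd_simp.
apply: (@le_lt_trans _ _ (u0 `^ eta / eta)%:E); last exact: ltry.
have cvgF : ((\int[mu]_(s in F n) (s `^ (eta - 1))%:E)%E @[n --> \oo] -->
    (\int[mu]_(s in \bigcup_n F n) (s `^ (eta - 1))%:E)%E).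
  apply: ge0_nondecreasing_set_cvg_integral.
  - apply/nondecreasing_seqP => n; rewrite subsetEset => s; rewrite /F/= !in_itv/=.
    move=> /andP[ns ->]; rewrite andbT; apply: le_trans ns.
    by rewrite ler_pM2l// lef_pV2 ?posrE// ler_nat.
  - by move=> n; exact: measurable_itv.
  - by move=> n; apply: mp; exact: measurable_itv.
  - by move=> n s _; rewrite lee_fin powR_ge0.
rewrite -(cvg_lim _ cvgF)//; apply: lime_le; first exact: cvgP cvgF.
apply: nearW => n; have /andP[a0 au] := an n.
have cpow (b s : R) : 0 < s -> {for s, continuous (fun s : R => s `^ b)}.
  move=> s0; apply: differentiable_continuous; apply/derivable1_diffP.
  by apply: derivable_powR; rewrite in_itv/= s0.
have der (s : R) : 0 < s -> is_derive s 1 (fun s : R => eta^-1 *: s `^ eta) (s `^ (eta - 1)).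
  move=> s0; have D := is_derive1_powR eta s0.
  by apply: is_derive_eq; rewrite /GRing.scale/= mulrA mulVf ?mul1r// gt_eqF.
have pos (s : R) : s \in `]u0 / n.+2%:R, u0[ -> 0 < s.
  by rewrite in_itv/= => /andP[+ _]; exact: lt_trans.
rewrite (@continuous_FTC2 _ _ (fun s => eta^-1 *: s `^ eta) _ _ au).
- rewrite -EFinB lee_fin /GRing.scale/= mulrC gerBl mulr_ge0 ?powR_ge0// invr_ge0 ltW//.
- apply: continuous_in_subspaceT => s; rewrite inE/= in_itv/= => /andP[s1 _].
  by apply: cpow; exact: lt_le_trans s1.
- split.
  + by move=> s /pos s0; have [] := der s s0.
  + apply: cvg_at_right_filter; apply: cvgZr; exact: cpow.
  + apply: cvg_at_left_filter; apply: cvgZr; exact: cpow.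
- move=> s /pos s0; rewrite derive1E; have D := der s s0.
  by rewrite derive_val.
Qed.

Lemma power_modulus_integral_lt_pinfty (g : R -> \bar R) (u0 eta C : R) :
  0 < u0 -> 0 < eta -> 0 <= C ->
  (forall s, 0 < s < u0 -> (0 <= g s)%E /\ (g s <= (C * s `^ eta)%:E)%E) ->
  (\int[mu]_(s in `]0%R, u0[) (g s * (s^-1)%:E) < +oo)%E.
Proof.
move=> u00 eta0 C0 gC.
apply: (@le_lt_trans _ _ (\int[mu]_(s in `]0%R, u0[) (C%:E * (s `^ (eta - 1))%:E))%E).
  apply: nonmeasurable_le_integral => s /=; rewrite in_itv/= => s0u.
    have /andP[s0 _] := s0u; have [g0 _] := gC s s0u.
    by rewrite mule_ge0// lee_fin invr_ge0 ltW.
  have /andP[s0 _] := s0u; have [_ gs] := gC s s0u.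
  apply: (@le_trans _ _ ((C * s `^ eta)%:E * (s^-1)%:E)%E).
    by apply: lee_wpmul2r => //; rewrite lee_fin invr_ge0 ltW.
  rewrite -!EFinM lee_fin -mulrA ler_wpM2l//.
  by rewrite powRB; [rewrite powRr1// ltW|rewrite (gt_eqF s0) implybT].
rewrite ge0_integralZl_EFin//; last first.
- by apply/measurable_EFinP; apply: measurable_funTS; exact: measurable_powR.
- by move=> s _; rewrite lee_fin powR_ge0.
by rewrite lte_mul_pinfty// integral_powR_lt_pinfty.
Qed.

End integral_comparison.

(** * Landau remainders at infinity from explicit bounds *)

Section landau_at_pinfty.
Context (R : realType).

Lemma eqaddo_pinfty (f g e : R -> R) :
  (forall eps, 0 < eps -> \forall t \near +oo, `|f t - g t| <= eps * `|e t|) ->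
  forall t : R, f t = g t +o_(t \near +oo) (e t).
Proof.
move=> h t; rewrite littleoE => [|eps eps0]; last exact: h.
by rewrite /= addrC subrK.
Qed.

Lemma eqaddO_pinfty (f g e : R -> R) (C : R) : 0 < C ->
  (\forall t \near +oo, `|f t - g t| <= C * `|e t|) ->
  forall t : R, f t = g t +O_(t \near +oo) (e t).
Proof.
move=> C0 h t; rewrite bigOE; first by rewrite /= addrC subrK.
by apply/bigO_exP; exists C.
Qed.

End landau_at_pinfty.

(** * Bounds and measurability for the cotangent *)

Section cotangent.
Context (R : realType).

(** The function F(y) = sin y - y cos y has derivative y sin y and vanishes at 0, so the mean value
    theorem and the monotonicity of sin give 0 <= F(x) <= x^2 sin x. Dividing by x sin x turns F(x)
    into 1 / x - cot x. *)
Lemma cot_bounds (x : R) : 0 < x < pi / 2 -> x^-1 - x <= cot x <= x^-1.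
Proof.
move=> /andP[x0 xpi].
have sx0 : 0 < sin x by apply: sin_gt0_pi; rewrite x0/=; have := pi_gt0 R; lra.
pose F (y : R) := sin y - y * cos y.
have dF (y : R) : is_derive y 1 F (y * sin y).
  by apply: is_derive_eq; rewrite /GRing.scale/=; ring.
have cF : {within `[0, x], continuous F}.
  apply: continuous_subspaceT => y; apply: differentiable_continuous.
  by apply/derivable1_diffP; have [] := dF y.
have [y] := @MVT R F (fun y => y * sin y) 0 x x0 (fun y _ => dF y) cF.
rewrite in_itv/= => /andP[y0 yx]; rewrite /F sin0 mul0r !subr0 => Fx.
have syx : sin y <= sin x.
  by apply/ltW; rewrite ltr_sin// in_itv/=; apply/andP; split; lra.
have sy0 : 0 < sin y by apply: sin_gt0_pi; rewrite y0/=; have := pi_gt0 R; lra.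
have F0 : 0 <= sin x - x * cos x by rewrite Fx !mulr_ge0// ltW.
have F1 : sin x - x * cos x <= x * sin x * x.
  by rewrite Fx; apply: ler_wpM2r; [exact: ltW|apply: ler_pM => //; exact: ltW].
rewrite /cot; apply/andP; split.
  rewrite ler_pdivlMr// -(ler_pM2l x0) mulrA mulrBr mulfV ?gt_eqF//.
  by rewrite mulrBl mul1r; lra.
by rewrite ler_pdivrMr// -(ler_pM2l x0) mulrA mulfV ?gt_eqF// mul1r; lra.
Qed.

(** With 0^-1 = 0, inversion is discontinuous at 0; it is rewritten as x times a real power of x^2,
    which is measurable. *)
Lemma measurable_inv : measurable_fun setT (fun x : R => x^-1).
Proof.
have -> : (fun x : R => x^-1) = fun x => x * (x ^+ 2) `^ (-1).
  apply/funext => x; have [->|x0] := eqVneq x 0; first by rewrite invr0 mul0r.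
  by rewrite powR_inv1 ?sqr_ge0// expr2 invfM mulrA mulfV// mul1r.
apply: measurable_funM => //.
apply: (measurableT_comp (measurable_powR _)); exact: measurable_funX.
Qed.

Lemma measurable_cot : measurable_fun setT (@cot R).
Proof.
apply: (@measurable_funM _ _ _ _ cos (fun x => (sin x)^-1)).
  by apply: continuous_measurable_fun; exact: continuous_cos.
apply: (measurableT_comp measurable_inv).
by apply: continuous_measurable_fun; exact: continuous_sin.
Qed.

End cotangent.

(** * Uniform variables and almost sure comparison *)

Section uniform_margins.
Context (R : realType) (d : measure_display) (T : measurableType d)
  (P : probability T R).

Lemma uniform_prob_itv (a b : R) : 0 <= a -> a < b -> b <= 1 ->
  uniform_prob (@ltr01 R) `]a, b[ = (b - a)%:E.
Proof.
move=> a0 ab b1; rewrite /uniform_prob.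
rewrite (eq_integral (cst 1%E)); last first.
  move=> x; rewrite inE/= in_itv/= => /andP[ax xb].
  rewrite /uniform_pdf ifT ?subr0 ?invr1//; apply/andP; split; lra.
have E : lebesgue_measure (`]a, b[%classic : set R) = (b - a)%:E.
  by rewrite lebesgue_measure_itv/= lte_fin ab EFinB.
by rewrite integral_cst// mul1e; exact: E.
Qed.

Lemma le_prob_ae (A B : set T) : measurable A -> measurable B ->
  (\forall x \ae P, A x -> B x) -> (P A <= P B)%E.
Proof.
move=> mA mB [N [mN N0 AB]]; rewrite -[leRHS]adde0 -N0.
apply: le_trans (measureU2 _ mB mN); apply: le_measure; rewrite ?inE//.
  exact: measurableU.
move=> x Ax; have [Bx|nBx] := pselect (B x); first by left.
by right; apply: AB => /= h; apply: nBx; exact: h.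
Qed.

Lemma fine_le_prob_ae (A B : set T) : measurable A -> measurable B ->
  (\forall x \ae P, A x -> B x) -> fine (P A) <= fine (P B).
Proof. by move=> mA mB AB; apply: fine_le; rewrite ?pr_fin_num// le_prob_ae. Qed.

Lemma uniform_ae01 (U : {RV P >-> R}) :
  (forall A : set R, measurable A -> distribution P U A = uniform_prob (@ltr01 R) A) ->
  \forall x \ae P, 0 < U x < 1.
Proof.
move=> hU; have mU : measurable (U @^-1` `]0%R, 1%R[).
  by rewrite -[X in measurable X]setTI; exact: (measurable_funP U).
exists (~` (U @^-1` `]0%R, 1%R[)); split; first exact: measurableC.
  rewrite probability_setC//; have := hU `]0%R, 1%R[%classic (measurable_itv _).
  by rewrite uniform_prob_itv// subr0 /distribution /pushforward => ->; rewrite subee.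
by move=> x /= h h'; apply: h; move: h'; rewrite in_itv.
Qed.

End uniform_margins.

(** * Remainders and assembly *)

Section tail_remainders.
Context (R : realType).

Lemma near_pinftyP (Q : R -> Prop) :
  (\forall t \near +oo, Q t) <-> exists t0, forall t, t0 <= t -> Q t.
Proof.
split => [[t0 [_ h]]|[t0 h]].
  by exists (t0 + 1) => t tt0; apply: h; lra.
by exists t0; split; [exact: num_real|move=> t /ltW; exact: h].
Qed.

Lemma ln_ge_near (A : R) : exists t0 : R, 1 <= t0 /\ forall t, t0 <= t -> A <= ln t.
Proof.
exists (Num.max 1 (expR A)); split; first by rewrite le_max lexx.
move=> t; rewrite ge_max => /andP[t1 tA].
by rewrite -[A]expRK ler_ln ?posrE ?expR_gt0//; lra.
Qed.

(** A logarithmic Cesaro argument: the sum is split at an index beyond which [o] is small; the head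
    is a constant and the rest is a small multiple of the harmonic sum. Dividing by C + 1 rather
    than C also covers C = 0. *)
Lemma little_o_of_weighted_sum (err : R -> R) (o : nat -> R) (C t0 : R) (N : nat) :
  0 <= C -> (1 < N)%N -> (forall n, (N <= n)%N -> 0 <= o n) ->
  (forall eps, 0 < eps -> exists n0, forall n, (n0 <= n)%N -> o n <= eps) ->
  (forall t, t0 <= t -> `|err t| <=
     C / t ^+ 2 * (1 + \sum_(N <= n < Num.truncn t) o n / n%:R)) ->
  forall eps, 0 < eps -> \forall t \near +oo, `|err t| <= eps * `|ln t / t ^+ 2|.
Proof.
move=> C0 N1 o0 ocvg herr eps eps0.
have C1 : 0 < 2 * (C + 1) by lra.
have [n0' hn0'] := ocvg (eps / (2 * (C + 1))) (divr_gt0 eps0 C1).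
pose n0 := maxn N n0'.
have hn0 n : (n0 <= n)%N -> 0 <= o n <= eps / (2 * (C + 1)).
  by rewrite geq_max => /andP[Nn nn]; rewrite o0//= hn0'.
pose A := \sum_(N <= n < n0) o n / n%:R.
have A0 : 0 <= A.
  rewrite /A big_nat; apply: sumr_ge0 => n /andP[Nn _].
  by rewrite divr_ge0// o0.
(* From here on the constant part C (1 + A) is at most (eps / 2) ln t; the other half of eps pays
   for the rest of the sum. *)
have [t1 [t11 ht1]] := ln_ge_near (2 * C * (1 + A) / eps).
apply/near_pinftyP; exists (Num.max (Num.max t0 t1) n0.+1%:R) => t.
rewrite !ge_max => /andP[/andP[tt0 tt1] tn0].
have t0' : 0 < t by lra.
have t2 : 0 < t ^+ 2 by rewrite exprn_gt0.
have lnt0 : 0 <= ln t by rewrite ln_ge0//; lra.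
have n0K : (n0 <= Num.truncn t)%N.
  rewrite truncn_ge_nat; last exact: ltW.
  by apply: le_trans tn0; rewrite ler_nat.
have n01 : (1 < n0)%N by rewrite leq_max N1.
have S : \sum_(N <= n < Num.truncn t) o n / n%:R <= A + eps / (2 * (C + 1)) * ln t.
  rewrite (big_cat_nat (leq_maxl N n0') n0K)/= lerD2l.
  apply: (@le_trans _ _ (eps / (2 * (C + 1)) * \sum_(n0 <= n < Num.truncn t) (1 / n%:R))).
    rewrite mulr_sumr big_nat [leRHS]big_nat; apply: ler_sum => n /andP[nn _].
    by rewrite mul1r ler_wpM2r//; case/andP: (hn0 n nn).
  apply: ler_wpM2l; first by rewrite divr_ge0// ltW.
  apply: le_trans (sum_inv_le _ _) _; first by rewrite n01.
  rewrite ler_ln ?posrE//; last by rewrite ltr0n (leq_trans _ n0K)// ltnW.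
  by rewrite truncn_le ltW.
apply: le_trans (herr t tt0) _.
rewrite ger0_norm ?divr_ge0 ?(ltW t2)// mulrAC mulrA ler_wpM2r ?invr_ge0 ?(ltW t2)//.
apply: (le_trans (ler_wpM2l C0 (lerD (lexx 1) S))).
have h1 := ht1 t tt1; rewrite ler_pdivrMr// in h1.
have h2 : C * (eps / (2 * (C + 1)) * ln t) <= eps / 2 * ln t.
  rewrite mulrA ler_wpM2r// mulrA ler_pdivrMr//; nra.
by nra.
Qed.

(** Replacing t by t + c moves a / t by at most a c / t^2, and rescaling by a shifts the logarithm
    by ln a; both effects are O(t^-2). The error [E] is left general, since it is a constant for the
    O expansion and a multiple of ln for the o expansion; being monotone, it is controlled at both
    ends by its value at (t + c) / a. *)
Lemma tail_transfer (f h E : R -> R) (a c K t0 : R) :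
  0 < a -> 0 <= c -> 0 <= K ->
  (forall t, 0 < t -> f ((t + c) / a) <= h t <= f (t / a)) ->
  (forall s t, t0 <= s <= t -> E s <= E t) ->
  (forall t, t0 <= t -> `|f t - (1 / t + K * (ln t / t ^+ 2))| <= E t / t ^+ 2) ->
  exists t1 C : R, [/\ 1 <= t1, 0 < C & forall t, t1 <= t ->
    `|h t - (a / t + a ^+ 2 * K * (ln t / t ^+ 2))|
      <= (a ^+ 2 * E ((t + c) / a) + C) / t ^+ 2].
Proof.
move=> a0 c0 K0 fh Emon fE.
exists (1 + a * `|t0|), (a * c + K * a ^+ 2 * (2 * c + `|ln a|) + 1).
have at0 : 0 <= a * `|t0| by rewrite mulr_ge0// ltW.
have a20 : 0 <= a ^+ 2 by rewrite sqr_ge0.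
split; first by lra.
  by rewrite ltr_wpDl// !(addr_ge0, mulr_ge0)// ltW.
move=> t tt1; have t1 : 1 <= t by lra.
have t0' : 0 < t by lra.
have tc : 0 < t + c by lra.
have t2 : 0 < t ^+ 2 by rewrite exprn_gt0.
have ta : t0 <= t / a.
  by rewrite ler_pdivlMr// mulrC (le_trans (ler_wpM2l (ltW a0) (ler_norm _)))//; lra.
have tca : t / a <= (t + c) / a by rewrite ler_pM2r ?invr_gt0//; lra.
have lnt : 0 <= ln t by rewrite ln_ge0.
(* This turns the correction 2 c ln t / t^3, caused by the shift, into 2 c / t^2. *)
have lntt : ln t <= t.
  have := @le_ln1Dx R (t - 1); rewrite addrCA subrr addr0 => H.
  by apply: le_trans (H _) _; lra.
have Et : E (t / a) <= E ((t + c) / a) by apply: Emon; rewrite ta tca.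
have /andP[hl hu] := fh t t0'.
have := fE _ ta; have := fE _ (le_trans ta tca); rewrite !ler_norml.
move=> /andP[fl _] /andP[_ fu].
have lna := ler_norm (ln a); have lna' := ler_norm (- ln a); rewrite normrN in lna'.
set E' := E ((t + c) / a) in Et fl *; set b := `|ln a| in lna lna' *.
have b0 : 0 <= b by exact: normr_ge0.
have E'0 : 0 <= E'.
  have := le_trans (normr_ge0 _) (fE _ (le_trans ta tca)).
  by rewrite pmulr_lge0// invr_gt0 exprn_gt0// divr_gt0.
have up : h t <= a / t + a ^+ 2 * K * (ln t / t ^+ 2) + (a ^+ 2 * E' + K * a ^+ 2 * b) / t ^+ 2.
  apply: (le_trans hu).
  have e1 : 1 / (t / a) = a / t by field; rewrite !gt_eqF.
  have e2 : (t / a) ^- 2 = a ^+ 2 / t ^+ 2 by field; rewrite !gt_eqF.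
  have e3 : ln (t / a) = ln t - ln a by rewrite ln_div.
  rewrite e1 e2 e3 in fu.
  have q1 : E (t / a) * (a ^+ 2 / t ^+ 2) <= E' * (a ^+ 2 / t ^+ 2).
    by apply: ler_wpM2r => //; rewrite divr_ge0// ltW.
  have q2 : 0 <= K * (a ^+ 2 / t ^+ 2) by rewrite mulr_ge0// divr_ge0// ltW.
  have q3 := ler_wpM2l q2 lna'.
  by lra.
have lo : a / t + a ^+ 2 * K * (ln t / t ^+ 2) -
    (a ^+ 2 * E' + a * c + K * a ^+ 2 * (2 * c + b)) / t ^+ 2 <= h t.
  apply: le_trans hl.
  have e1 : 1 / ((t + c) / a) = a / (t + c) by field; rewrite !gt_eqF.
  have e2 : ((t + c) / a) ^- 2 = a ^+ 2 / (t + c) ^+ 2 by field; rewrite !gt_eqF.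
  have e3 : ln ((t + c) / a) = ln (t + c) - ln a by rewrite ln_div.
  rewrite e1 e2 e3 in fl.
  have tc2 : 0 < (t + c) ^+ 2 by rewrite exprn_gt0.
  have p1 : a / t - a * c / t ^+ 2 <= a / (t + c).
    rewrite (_ : a / t - a * c / t ^+ 2 = a * (t - c) / t ^+ 2); last first.
      by field; rewrite !gt_eqF.
    have c3 : 0 <= a * c ^+ 2 by rewrite mulr_ge0 ?sqr_ge0// ltW.
    by rewrite ler_pdivrMr// mulrAC ler_pdivlMr//; nra.
  have inv : (t + c) ^- 2 <= t ^- 2.
    by rewrite lef_pV2 ?posrE//; nra.
  have p2 : ln t * t ^- 2 - 2 * c * t ^- 2 <= ln t * (t + c) ^- 2.
    have : t ^- 2 - 2 * c / t ^+ 3 <= (t + c) ^- 2.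
      rewrite (_ : t ^- 2 - 2 * c / t ^+ 3 = (t - 2 * c) / t ^+ 3); last first.
        by field; rewrite !gt_eqF.
      rewrite ler_pdivrMr ?exprn_gt0// [leRHS]mulrC ler_pdivlMr//.
      have : 0 <= c ^+ 2 * (3 * t + 2 * c) by rewrite mulr_ge0 ?sqr_ge0//; lra.
      by rewrite !exprS expr0; nra.
    move/(ler_wpM2l lnt); apply: le_trans; rewrite mulrBr lerD2l lerN2.
    apply: (@le_trans _ _ (t * (2 * c / t ^+ 3))).
      by apply: ler_wpM2r => //; rewrite !(mulr_ge0, invr_ge0, exprn_ge0)// ltW.
    by rewrite le_eqVlt; apply/orP; left; apply/eqP; field; rewrite !gt_eqF.
  have lntc : ln t <= ln (t + c) by rewrite ler_ln ?posrE//; lra.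
  have p3 : ln t * t ^- 2 - 2 * c * t ^- 2 - b * t ^- 2 <= (ln (t + c) - ln a) * (t + c) ^- 2.
    have r1 : ln t * (t + c) ^- 2 <= ln (t + c) * (t + c) ^- 2.
      by apply: ler_wpM2r => //; rewrite invr_ge0 ltW.
    have r2 : ln a * (t + c) ^- 2 <= b * t ^- 2.
      apply: (@le_trans _ _ (b * (t + c) ^- 2)).
        by apply: ler_wpM2r => //; rewrite invr_ge0 ltW.
      exact: ler_wpM2l.
    by lra.
  have Ka : 0 <= K * a ^+ 2 by rewrite mulr_ge0.
  have p4 := ler_wpM2l Ka p3.
  have p5 : E' * (a ^+ 2 / (t + c) ^+ 2) <= E' * (a ^+ 2 / t ^+ 2).
    by apply: ler_wpM2l => //; exact: ler_wpM2l.
  by lra.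
have t2i : 0 < t ^- 2 by rewrite invr_gt0.
have z1 : 0 <= a * c * t ^- 2 by rewrite !mulr_ge0// ltW.
have z2 : 0 <= K * a ^+ 2 * (2 * c) * t ^- 2 by rewrite !mulr_ge0// ltW.
apply/andP; split; lra.
Qed.

End tail_remainders.

(** * Weighted sums of reciprocals and of cotangents *)

Section weighted_reciprocals.
Context (R : realType) (d : measure_display)
  (T : measurableType d) (P : probability T R) (m : nat)
  (U : 'I_m -> {RV P >-> R}) (w : 'I_m -> R)
  (c : forall I : {set 'I_m}, #|I|.-tuple (measurableTypeR R) -> R)
  (u0 : R) (M : {set 'I_m} -> R) (lam : 'I_m -> 'I_m -> R)
  (U_uniform : forall (i : 'I_m) (A : set R), measurable A ->
     distribution P (U i) A = uniform_prob (@ltr01 R) A)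
  (w_gt0 : forall i, 0 < w i) (w_sum1 : \sum_(i < m) w i = 1)
  (c_density : forall I : {set 'I_m}, (2 <= #|I|)%N ->
     is_marginal_density P U (@c I))
  (u0_itv : 0 < u0 < 1)
  (c_bounded : forall I : {set 'I_m}, (2 <= #|I|)%N ->
     (ess_sup_on (lebesgue_tuple R #|I|) (lower_boundary u0) (@c I)
      <= (M I)%:E)%E)
  (lam_sup : forall i j : 'I_m, (i < j)%N ->
     ess_sup_on (lebesgue_measure \x lebesgue_measure)%E (corner s)
       (pair_density c i j) @[s --> 0^'+] --> (lam i j)%:E)
  (lam_inf : forall i j : 'I_m, (i < j)%N ->
     ess_inf_on (lebesgue_measure \x lebesgue_measure)%E (corner s)
       (pair_density c i j) @[s --> 0^'+] --> (lam i j)%:E).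
Local Notation RT := (measurableTypeR R).
Local Notation mu := (@lebesgue_measure R).

(* Equal to w_i / U_i where U_i > 0, and to 0 elsewhere since 0^-1 = 0. *)
Let V (i : 'I_m) (x : T) : R := w i * (Num.max (U i x) 0)^-1.
Let W (i j : 'I_m) (s : R) : R := fine (omega (pair_density c i j) (lam i j) s).
(** Summing over the pairs gives a single modulus that serves all of them; the inverse appears
    because a threshold s on V_i corresponds to a corner of side 1 / s. *)
Let om (s : R) : R := \sum_(i < m) \sum_(j < m | (i < j)%N) W i j s^-1.
(** Only the values [lam i j] with i < j are corner limits, so they are extended symmetrically
    before summing over ordered pairs. *)
Let kap (i j : 'I_m) : R :=
  (if (i < j)%N then lam i j else if (j < i)%N then lam j i else 0) * w i * w j.
Let Mx : R := \sum_(I : {set 'I_m}) `|M I| + \sum_(i < m) \sum_(j < m) `|lam i j|.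

Let mU (i : 'I_m) (A : set RT) : measurable A -> measurable [set x | A (U i x)].
Proof.
by move=> mA; rewrite -[X in measurable X]setTI; exact: (measurable_funP (U i)).
Qed.

Let w_le1 (i : 'I_m) : w i <= 1.
Proof. by rewrite -w_sum1 (bigD1 i)//= lerDl sumr_ge0// => j _; exact: ltW. Qed.

Let M_le (I : {set 'I_m}) : M I <= Mx.
Proof.
rewrite /Mx (bigD1 I)//= -addrA; apply: (le_trans (ler_norm _)).
by rewrite lerDl addr_ge0// ?sumr_ge0// => j _; rewrite sumr_ge0.
Qed.

Let Mx_ge0 : 0 <= Mx.
Proof. by rewrite addr_ge0// sumr_ge0// => j _; rewrite sumr_ge0. Qed.

Let lam_le (i j : 'I_m) : `|lam i j| <= Mx.
Proof.
rewrite /Mx (bigD1 (P := predT) i)//= (bigD1 (P := predT) j)//=.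
rewrite -[leLHS]add0r lerD ?sumr_ge0// -addrA lerDl addr_ge0// ?sumr_ge0// => k _.
by rewrite sumr_ge0.
Qed.

Let card_pair (i j : 'I_m) : i != j -> (2 <= #|[set i; j]%SET|)%N.
Proof. by move=> ij; rewrite cards2 ij. Qed.

Let c_boundedM (I : {set 'I_m}) : (2 <= #|I|)%N ->
  (ess_sup_on (lebesgue_tuple R #|I|) (lower_boundary u0) (@c I) <= Mx%:E)%E.
Proof. by move=> /c_bounded/le_trans; apply; rewrite lee_fin. Qed.

Lemma prob_pair_le (i j : 'I_m) (A B : set RT) (a b : R) : i != j ->
  measurable A -> measurable B -> A `<=` [set u | u <= u0] ->
  mu A = a%:E -> mu B = b%:E ->
  fine (P [set x | A (U i x) /\ B (U j x)]) <= Mx * (a * b).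
Proof.
move=> ij mA mB Au Aa Bb; pose D k := if k == i then A else B.
have mE : measurable [set x | A (U i x) /\ B (U j x)].
  by apply: measurableI; exact: mU.
rewrite -lee_fin fineK ?fin_num_measure//.
have iI : i \in [set i; j]%SET by rewrite !inE eqxx.
have mD k : measurable (D k) by rewrite /D; case: ifP.
have Du : D i `<=` [set u | u <= u0] by rewrite /D eqxx.
have := prob_box_le_ess_sup (c_density (card_pair ij)) Mx_ge0
  (c_boundedM (card_pair ij)) mD iI Du.
rewrite big_setU1 ?inE//= big_set1 /D eqxx [j == i]eq_sym (negbTE ij) Aa Bb -!EFinM.
apply: le_trans; apply: le_measure; rewrite ?inE//.
  rewrite (_ : mkset _ = [set x | A (U i x) /\ B (U j x)])//.
  apply/seteqP; split => x /=.
    move=> h; split; first by have := h i; rewrite !inE eqxx; apply.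
    by have := h j; rewrite !inE eqxx orbT [j == i]eq_sym (negbTE ij); apply.
  move=> [Ax Bx] k; rewrite !inE => /orP[|] /eqP ->; first by rewrite eqxx.
  by rewrite [j == i]eq_sym (negbTE ij).
move=> x [Ax Bx] k; rewrite !inE => /orP[|] /eqP ->; first by rewrite eqxx.
by rewrite [j == i]eq_sym (negbTE ij).
Qed.

Lemma prob_triple_le (i j k : 'I_m) (A B C : set RT) (a b e : R) :
  j != i -> k != i -> k != j ->
  measurable A -> measurable B -> measurable C -> A `<=` [set u | u <= u0] ->
  mu A = a%:E -> mu B = b%:E -> mu C = e%:E ->
  fine (P [set x | A (U i x) /\ (B (U j x) /\ C (U k x))]) <= Mx * (a * (b * e)).
Proof.
move=> ji ki kj mA mB mC Au Aa Bb Ce.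
pose D l := if l == i then A else if l == j then B else C.
pose I := (i |: [set j; k])%SET.
have iI : i \in I by rewrite !inE eqxx.
have inot : i \notin [set j; k]%SET.
  by rewrite !inE negb_or eq_sym ji eq_sym ki.
have card : (2 <= #|I|)%N by rewrite cardsU1 inot cards2 eq_sym kj.
have mD l : measurable (D l) by rewrite /D; case: ifP => // _; case: ifP.
have Du : D i `<=` [set u | u <= u0] by rewrite /D eqxx.
have Dj : D j = B by rewrite /D (negbTE ji) eqxx.
have Dk : D k = C by rewrite /D (negbTE ki) (negbTE kj).
have mE : measurable [set x | A (U i x) /\ (B (U j x) /\ C (U k x))].
  by apply: measurableI; [exact: mU|apply: measurableI; exact: mU].
rewrite -lee_fin fineK ?fin_num_measure//.
have := prob_box_le_ess_sup (c_density card) Mx_ge0 (c_boundedM card) mD iI Du.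
have jk : j \notin [set k]%SET by rewrite inE eq_sym.
rewrite big_setU1//= big_setU1//= big_set1 Dj Dk {2}/D eqxx Aa Bb Ce -!EFinM.
apply: le_trans; rewrite le_eqVlt; apply/orP; left; apply/eqP; congr (P _).
apply/seteqP; split => x /=.
  move=> [Ax [Bx Cx]] l; rewrite !inE => /orP[/eqP ->|/orP[|] /eqP ->].
  - by rewrite /D eqxx.
  - by rewrite Dj.
  - by rewrite Dk.
move=> h; split; first by have := h i; rewrite /D !inE eqxx; apply.
split; first by have := h j; rewrite Dj !inE eqxx orbT; apply.
by have := h k; rewrite Dk !inE eqxx !orbT; apply.
Qed.

Let V_gtE (i : 'I_m) (x : T) (a : R) : 0 < a ->
  (a < V i x) = (0 < U i x < w i / a).
Proof.
move=> a0; rewrite /V; case: (ltP 0 (U i x)) => Ux /=; last first.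
  by rewrite invr0 mulr0 ltNge ltW.
by rewrite ltr_pdivlMr// ltr_pdivlMr// mulrC.
Qed.

Let V_gt (i : 'I_m) (x : T) (a : R) : 0 < a ->
  (a < V i x) <-> `]0%R, w i / a[%classic (U i x).
Proof. by move=> a0; rewrite V_gtE//= in_itv. Qed.

Let V_bin (i : 'I_m) (x : T) (a b : R) : 0 < a <= b ->
  (a < V i x <= b) <-> `[w i / b, w i / a[%classic (U i x).
Proof.
move=> /andP[a0 ab]; have b0 : 0 < b by lra.
rewrite leNgt !V_gtE//= in_itv/= negb_and -!leNgt.
have wb : 0 < w i / b by rewrite divr_gt0.
split => [/andP[/andP[U0 Ua] /orP[|->]]|/andP[Ub Ua]]; rewrite ?Ua//; first lra.
by rewrite Ub orbT !andbT; lra.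
Qed.

Let mu_tail (i : 'I_m) (a : R) : 0 < a -> mu `]0%R, w i / a[%classic = (w i / a)%:E.
Proof.
move=> a0; rewrite lebesgue_measure_itv/= lte_fin divr_gt0//.
by rewrite -EFinB subr0.
Qed.

Let mu_bin (i : 'I_m) (a b : R) : 0 < a <= b ->
  mu `[w i / b, w i / a[%classic = (w i * (1 / a - 1 / b))%:E.
Proof.
move=> /andP[a0 ab]; have b0 : 0 < b by lra.
rewrite lebesgue_measure_itv/= lte_fin; case: ltP => [_|h].
  by rewrite -EFinB mulrBr !mulrA mulr1.
move: h; rewrite ler_pM2l// lef_pV2 ?posrE// => ba.
have -> : a = b by lra.
by rewrite subrr mulr0.
Qed.

Let W_ge0 (i j : 'I_m) (s : R) : 0 < s -> 0 <= W i j s.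
Proof. by move=> s0; rewrite fine_ge0// omega_ge0. Qed.

Let W_le_om (i j : 'I_m) (s : R) : (i < j)%N -> 0 < s -> W i j s^-1 <= om s.
Proof.
move=> ij s0; have si : 0 < s^-1 by rewrite invr_gt0.
rewrite /om (bigD1 i)//= (bigD1 j)//= -addrA lerDl.
by rewrite addr_ge0// ?sumr_ge0// => k _; rewrite ?W_ge0// sumr_ge0// => l _; exact: W_ge0.
Qed.

Let ltn_neq (i j : 'I_m) : (i < j)%N -> i != j.
Proof. by move=> ij; rewrite -val_eqE/= neq_ltn ij. Qed.

Let lam_ge0 (i j : 'I_m) : (i < j)%N -> 0 <= lam i j.
Proof.
move=> ij; have nij := ltn_neq ij.
exact: (corner_limit_ge0 (c_density (card_pair nij)) (lam_inf ij)).
Qed.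

Let kap_bound (i j : 'I_m) : 0 <= kap i j <= Mx.
Proof.
rewrite /kap -mulrA; set l := (X in X * _).
have /andP[l0 lM] : 0 <= l <= Mx.
  rewrite /l; case: ltngtP => [ij|ji|_]; last by rewrite lexx.
    by rewrite lam_ge0//= (le_trans (ler_norm _)).
  by rewrite lam_ge0//= (le_trans (ler_norm _)).
rewrite !mulr_ge0 ?(ltW (w_gt0 _))//=.
by apply: le_trans lM; rewrite ler_piMr// mulr_ile1 ?(ltW (w_gt0 _)).
Qed.

Let w_div_le (i : 'I_m) (s a : R) : 0 < s <= a -> w i / a <= s^-1.
Proof.
move=> /andP[s0 sa]; have a0 : 0 < a by lra.
rewrite ler_pdivrMr// ler_pdivlMl//.
by apply: le_trans sa; rewrite ler_piMr ?w_le1// ltW.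
Qed.

Let tail_subset (i : 'I_m) (s a : R) : 0 < s <= a ->
  `]0%R, w i / a[%classic `<=` `]0%R, s^-1]%classic.
Proof.
move=> /(w_div_le i) wa x; rewrite /= !in_itv/= => /andP[-> xa].
by rewrite (le_trans (ltW xa)).
Qed.

Let bin_subset (i : 'I_m) (s a b : R) : 0 < s -> s <= a <= b ->
  `[w i / b, w i / a[%classic `<=` `]0%R, s^-1]%classic.
Proof.
move=> s0 /andP[sa ab] x; rewrite /= !in_itv/= => /andP[xb xa].
have b0 : 0 < b by lra.
have sa' : 0 < s <= a by rewrite s0.
by rewrite (lt_le_trans (divr_gt0 (w_gt0 i) b0) xb)/= (le_trans (ltW xa))// w_div_le.
Qed.

Let V_tail (i : 'I_m) (x : R) : 1 <= x -> pr P (fun y => x < V i y) = w i / x.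
Proof.
move=> x1; have x0 : 0 < x by lra.
have wx : w i / x <= 1 by rewrite ler_pdivrMr// mul1r (le_trans (w_le1 i)).
rewrite /pr (_ : [set y | x < V i y] = U i @^-1` `]0%R, w i / x[%classic); last first.
  by apply/seteqP; split => y /V_gt; apply.
have := U_uniform i (measurable_itv `]0%R, w i / x[).
rewrite uniform_prob_itv ?divr_gt0// subr0 /distribution /pushforward => ->.
by [].
Qed.

(* Twice 1 / u0, so that 2 / (N - 1) < u0 as soon as N >= 2 x0. *)
Let x0 : R := 2 / u0.

Let x0_facts : 2 < x0 /\ x0^-1 < u0.
Proof.
have /andP[u00 u01] := u0_itv; rewrite /x0 invf_div; split.
  by rewrite ltr_pdivlMr//; lra.
by rewrite ltr_pdivrMr//; lra.
Qed.

Let V_pair (i j : 'I_m) (a e : R) : i != j -> x0 <= a -> 0 < e ->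
  pr P (fun y => (a < V i y) && (e < V j y)) <= Mx / (a * e).
Proof.
move=> ij x0a e0; have [x02 x0u] := x0_facts; have a0 : 0 < a by lra.
rewrite /pr (_ : mkset _ = [set x | `]0%R, w i / a[%classic (U i x) /\
    `]0%R, w j / e[%classic (U j x)]); last first.
  by apply/seteqP; split => y /=; [move=> /andP[/V_gt h1 /V_gt h2]; split; [exact: h1|exact: h2]
    |move=> [h1 h2]; apply/andP; split; apply/V_gt].
have Au : `]0%R, w i / a[%classic `<=` [set u | u <= u0].
  move=> x; rewrite /= in_itv/= => /andP[_ xa]; apply: (le_trans (ltW xa)).
  by apply: (le_trans _ (ltW x0u)); apply: w_div_le; rewrite x0a andbT; lra.
apply: (le_trans (prob_pair_le ij (measurable_itv _) (measurable_itv _) Au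
  (mu_tail i a0) (mu_tail j e0))).
apply: ler_wpM2l => //; rewrite invfM mulrACA.
apply: ler_piMl; first by rewrite mulr_ge0// invr_ge0 ltW.
by rewrite mulr_ile1 ?(ltW (w_gt0 _)).
Qed.

Let V_triple (i j k : 'I_m) (a b e f : R) : j != i -> k != i -> k != j ->
  x0 <= a <= b -> 0 < e -> 0 < f ->
  pr P (fun y => [&& a < V i y <= b, e < V j y & f < V k y])
      <= Mx * (1 / a - 1 / b) / (e * f).
Proof.
move=> ji ki kj /andP[x0a ab] e0 f0; have [x02 x0u] := x0_facts.
have a0 : 0 < a <= b by rewrite ab andbT; lra.
have x00 : 0 < x0 by lra.
rewrite /pr (_ : mkset _ = [set x | `[w i / b, w i / a[%classic (U i x) /\
    (`]0%R, w j / e[%classic (U j x) /\ `]0%R, w k / f[%classic (U k x))]); last first.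
  apply/seteqP; split => y /=.
    move=> /and3P[/(V_bin _ _ a0) h1 /V_gt h2 /V_gt h3].
    by split => //; split; [exact: h2|exact: h3].
  by move=> [h1 [h2 h3]]; apply/and3P; split; [exact/(V_bin _ _ a0)|exact/V_gt|exact/V_gt].
have Au : `[w i / b, w i / a[%classic `<=` [set u | u <= u0].
  have ab' : x0 <= a <= b by rewrite x0a.
  move=> x /(bin_subset x00 ab'); rewrite /= in_itv/= => /andP[_ xa].
  by apply: (le_trans xa); exact: ltW.
apply: (le_trans (prob_triple_le ji ki kj (measurable_itv _) (measurable_itv _)
  (measurable_itv _) Au (mu_bin i a0) (mu_tail j e0) (mu_tail k f0))).
have ba : 0 <= 1 / a - 1 / b.
  by case/andP: a0 => ? ?; rewrite subr_ge0 !div1r lef_pV2 ?posrE//; lra.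
rewrite -[leRHS]mulrA; apply: ler_wpM2l => //.
have wij : w i * (w j * w k) <= 1.
  by rewrite mulr_ile1 ?mulr_ge0 ?mulr_ile1 ?(ltW (w_gt0 _)).
rewrite (_ : _ * _ = w i * (w j * w k) * ((1 / a - 1 / b) / (e * f))); last first.
  by rewrite invfM; ring.
by apply: ler_piMl => //; rewrite divr_ge0// mulr_ge0// ltW.
Qed.

Let V_pair_bin_lt (i j : 'I_m) (A B : set RT) (a b s : R) : (i < j)%N -> x0 <= s ->
  measurable A -> measurable B -> A `<=` `]0%R, s^-1] -> B `<=` `]0%R, s^-1] ->
  mu A = a%:E -> mu B = b%:E ->
  `|fine (P [set x | A (U i x) /\ B (U j x)]) - lam i j * a * b| <= om s * (a * b).
Proof.
move=> ij x0s mA mB As Bs Aa Bb; have [x02 x0u] := x0_facts.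
have nij := ltn_neq ij; have s0 : 0 < s by lra.
have su : 0 < s^-1 <= u0.
  by rewrite invr_gt0 s0/=; apply: le_trans (ltW x0u); rewrite lef_pV2 ?posrE//; lra.
apply: (le_trans (prob_pair_bin nij (c_density (card_pair nij)) u0_itv
  (c_boundedM (card_pair nij)) (lam_inf ij) su mA mB As Bs Aa Bb)).
rewrite -mulrA; apply: ler_wpM2r; last exact: W_le_om.
by apply: mulr_ge0; rewrite -lee_fin -?Aa -?Bb measure_ge0.
Qed.

Let V_pair_bin (i j : 'I_m) (s a b e : R) : i != j -> x0 <= s ->
  s <= a <= b -> s <= e ->
    `|pr P (fun y => (a < V i y <= b) && (e < V j y))
      - kap i j * (1 / a - 1 / b) / e| <= om s * (1 / a - 1 / b) / e.
Proof.
move=> ij x0s sab se; have /andP[sa ab] := sab; have [x02 x0u] := x0_facts.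
have s0 : 0 < s by lra.
have e0 : 0 < e by lra.
have a0 : 0 < a <= b by rewrite ab andbT; lra.
have se' : 0 < s <= e by rewrite s0.
have ba : 0 <= 1 / a - 1 / b.
  by case/andP: a0 => ? ?; rewrite subr_ge0 !div1r lef_pV2 ?posrE//; lra.
have om0 : 0 <= om s.
  by apply: sumr_ge0 => k _; apply: sumr_ge0 => l _; rewrite W_ge0// invr_gt0.
have fin : om s * ((w i * (1 / a - 1 / b)) * (w j / e)) <= om s * (1 / a - 1 / b) / e.
  rewrite -[leRHS]mulrA; apply: ler_wpM2l => //.
  rewrite mulrACA; apply: ler_piMl; first by rewrite mulr_ge0// invr_ge0 ltW.
  by rewrite mulr_ile1 ?(ltW (w_gt0 _)).
have E : [set y | (a < V i y <= b) && (e < V j y)] =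
  [set x | `[w i / b, w i / a[%classic (U i x) /\ `]0%R, w j / e[%classic (U j x)].
  apply/seteqP; split => y /=.
    by move=> /andP[/(V_bin _ _ a0) h1 /V_gt h2]; split => //; exact: h2.
  by move=> [h1 h2]; apply/andP; split; [exact/(V_bin _ _ a0)|exact/V_gt].
apply: le_trans fin; rewrite /pr E /kap.
(* The corner limit is given for increasing indices; when j < i the tail of V_j becomes the first
   edge of the box and the bin of V_i the second. *)
have [ji|ij'|eqij] := ltngtP j i; last by move/eqP: ij; case; exact/esym/val_inj.
  rewrite (_ : mkset _ = [set x | `]0%R, w j / e[%classic (U j x) /\
    `[w i / b, w i / a[%classic (U i x)]); last first.
    by apply/seteqP; split => y /= [].
  rewrite (_ : lam j i * w i * w j * _ / e =
     lam j i * (w j / e) * (w i * (1 / a - 1 / b))); last by ring.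
  rewrite [X in om s * X]mulrC.
  apply: (V_pair_bin_lt ji x0s (measurable_itv _) (measurable_itv _)).
  - exact: tail_subset.
  - exact: bin_subset.
  - exact: mu_tail.
  - exact: mu_bin.
rewrite (_ : lam i j * w i * w j * _ / e =
   lam i j * (w i * (1 / a - 1 / b)) * (w j / e)); last by ring.
apply: (V_pair_bin_lt ij' x0s (measurable_itv _) (measurable_itv _)).
- exact: bin_subset.
- exact: tail_subset.
- exact: mu_bin.
- exact: mu_tail.
Qed.

Let mV (i : 'I_m) : measurable_fun setT (V i).
Proof.
apply: measurable_funM => //; apply: (measurableT_comp (@measurable_inv R)).
by apply: measurable_maxr => //; exact: (measurable_funP (U i)).
Qed.

Let V_ge0 (i : 'I_m) (x : T) : 0 <= V i x.
Proof. by rewrite mulr_ge0 ?(ltW (w_gt0 _))// invr_ge0 le_max lexx orbT. Qed.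

Let L := \sum_(i < m) \sum_(j < m | (i < j)%N) lam i j * w i * w j.

Let kap_sum : \sum_i \sum_(j | j != i) kap i j = 2 * L.
Proof.
have E i : \sum_(j | j != i) kap i j =
    \sum_(j < m | (i < j)%N) lam i j * w i * w j +
    \sum_(j < m | (j < i)%N) lam j i * w j * w i.
  rewrite (bigID (fun j : 'I_m => (i < j)%N))/=; congr (_ + _).
    apply: eq_big => [j|j /andP[_ ij]]; last by rewrite /kap ij.
    by rewrite -val_eqE/=; case: ltngtP.
  apply: eq_big => [j|j /andP[ji ij]]; first by rewrite -val_eqE/=; case: ltngtP.
  rewrite /kap (negbTE ij); move: ji ij; rewrite -val_eqE/=.
  by case: ltngtP => // _ _ _; ring.
under eq_bigr do rewrite E.
rewrite big_split/= -/L (exchange_big_dep predT)//= mulrDl.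
by rewrite mul1r.
Qed.

Let u_ae : \forall x \ae P, forall i, 0 < U i x < 1.
Proof.
by apply: filter_forall => i; exact: uniform_ae01 (U_uniform i).
Qed.

Definition sum_reciprocals (x : T) : R := \sum_(i < m) w i * (U i x)^-1.

Lemma measurable_sum_reciprocals : measurable_fun setT sum_reciprocals.
Proof.
apply: measurable_sum => i; apply: measurable_funM => //.
by apply: (measurableT_comp (@measurable_inv R)); exact: (measurable_funP (U i)).
Qed.

Let measurable_gt (f : T -> R) (t : R) : measurable_fun setT f ->
  measurable [set x | t < f x].
Proof.
move=> mf; rewrite (_ : mkset _ = setT `&` f @^-1` `]t, +oo[); first exact: mf.
by apply/seteqP; split => x /=; rewrite in_itv/= andbT => // -[].
Qed.

Let tail_VE (t : R) : pr P (fun x => t < \sum_i V i x) =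
  fine (P [set x | t < sum_reciprocals x]).
Proof.
have mS : measurable_fun setT (fun x => \sum_i V i x) by exact: measurable_sum.
have VE : \forall x \ae P, \sum_i V i x = sum_reciprocals x.
  apply: filterS u_ae => x h; apply: eq_bigr => i _.
  by have /andP[Ui _] := h i; rewrite /V max_l// ltW.
apply/eqP; rewrite eq_le; apply/andP; split; apply: fine_le_prob_ae;
  try (exact: measurable_gt); try (exact: measurable_gt measurable_sum_reciprocals).
  by apply: filterS VE => x /= ->.
by apply: filterS VE => x /= ->.
Qed.

Lemma sum_reciprocals_tail : exists (C t0 : R) (N : nat),
  [/\ 0 <= C, (3 < N)%N, 2 / N.-1%:R < u0 & forall t : R, t0 <= t ->
  `|fine (P [set x | t < sum_reciprocals x]) - (1 / t + 2 * L * (ln t / t ^+ 2))| <=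
  C / t ^+ 2 * (1 + \sum_(N <= n < Num.truncn t) om (n%:R / 2) / n%:R)].
Proof.
have [x02 x0u] := x0_facts.
have x01 : 1 <= x0 by lra.
have om_ge0 s : x0 <= s -> 0 <= om s.
  move=> x0s; apply: sumr_ge0 => k _; apply: sumr_ge0 => l _.
  by rewrite W_ge0// invr_gt0; lra.
have V_tail' (i : 'I_m) (x : R) : x0 <= x -> pr P (fun y => x < V i y) = w i / x.
  by move=> x0x; apply: V_tail; lra.
have [C [t0 [N [C0 t01 N4 x0N h]]]] := tail_expansion mV V_ge0 (fun i => ltW (w_gt0 i))
  w_sum1 x01 kap_bound om_ge0 V_tail' V_pair V_pair_bin V_triple.
exists C, t0, N; split => //.
  have N1 : N%:R = N.-1%:R + 1 :> R by rewrite natr1 prednK// (leq_trans _ N4).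
  have n0 : 0 < N.-1%:R :> R by lra.
  have /andP[u00 u01] := u0_itv.
  rewrite ltr_pdivrMr// mulrC -ltr_pdivrMr//; rewrite -/x0; lra.
by move=> t tt0; have := h t tt0; rewrite tail_VE kap_sum.
Qed.

Lemma L_ge0 : 0 <= L.
Proof.
apply: sumr_ge0 => i _; apply: sumr_ge0 => j ij.
by rewrite !mulr_ge0 ?(ltW (w_gt0 _))// lam_ge0.
Qed.

Lemma om_cvg0 (eps : R) : 0 < eps ->
  exists n0, forall n, (n0 <= n)%N -> om (n%:R / 2) <= eps.
Proof.
(* There are at most m^2 pairs; the added 1 keeps the denominator positive. *)
move=> eps0; pose e := eps / (m%:R ^+ 2 + 1).
have m21 : 0 < m%:R ^+ 2 + 1 :> R by have := sqr_ge0 (m%:R : R); lra.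
have e0 : 0 < e by rewrite divr_gt0.
have : \forall s \near (0 : R)^'+, forall i j : 'I_m, (i < j)%N ->
    (omega (pair_density c i j) (lam i j) s <= e%:E)%E.
  apply: filter_forall => i; apply: filter_forall => j.
  have [ij|] := boolP (i < j)%N; last by move=> _; apply: nearW.
  by apply: filterS (omega_near0 (lam_sup ij) (lam_inf ij) e0).
move=> [del' /= del0' hdel]; pose del : R := del'; have del0 : 0 < del := del0'.
exists (Num.truncn (2 / del)).+1 => n nn.
have n0 : 0 < n%:R :> R by rewrite ltr0n (leq_trans _ nn).
have sdel : (0 : R) < 2 / n%:R < del.
  rewrite divr_gt0//= ltr_pdivrMr// -ltr_pdivrMl// mulrC.
  have d0 : 0 <= 2 / del by rewrite divr_ge0// ltW.
  have /andP[_ h] := truncn_itv d0.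
  by apply: lt_le_trans h _; rewrite ler_nat.
have W_le (i j : 'I_m) : (i < j)%N -> W i j (n%:R / 2)^-1 <= e.
  move=> ij; rewrite invf_div; have := hdel (2 / n%:R).
  have /andP[s0 sd] := sdel; rewrite /= sub0r normrN gtr0_norm// => /(_ sd s0 i j ij) h.
  rewrite -lee_fin; apply: le_trans h.
  have := omega_ge0 (pair_density c i j) (lam i j) s0; rewrite /W.
  by case: (omega _ _ _).
apply: (@le_trans _ _ (m%:R * (m%:R * e))).
  apply: sum_le_card => [|i _]; first by rewrite mulr_ge0// ltW.
  by apply: sum_le_card => [|j ij]; [exact: ltW|exact: W_le].
rewrite /e mulrA mulrA ler_pdivrMr//; have := mulr_ge0 (ltW eps0) (ler0n R 1); nra.
Qed.

Let D := forall i j : 'I_m, (i < j)%N ->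
    (\int[lebesgue_measure]_(s in `]0%R, u0[)
       (omega (pair_density c i j) (lam i j) s * (s^-1)%:E) < +oo)%E.

Let omega_finE (i j : 'I_m) (s : R) : (i < j)%N -> 0 < s <= u0 ->
  omega (pair_density c i j) (lam i j) s = (W i j s)%:E.
Proof.
move=> ij; have nij := ltn_neq ij.
exact: (omega_fin nij (c_density (card_pair nij)) (lam i j) u0_itv (c_boundedM (card_pair nij))).
Qed.

Lemma sum_om_bounded : D -> exists B, forall N K : nat, (1 < N)%N ->
  2 / N.-1%:R < u0 -> \sum_(N <= n < K) om (n%:R / 2) / n%:R <= B.
Proof.
move=> hD; pose I (i j : 'I_m) := (\int[lebesgue_measure]_(s in `]0%R, u0[)
       (omega (pair_density c i j) (lam i j) s * (s^-1)%:E))%E.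
exists (\sum_(i < m) \sum_(j < m | (i < j)%N) fine (I i j)) => N K N1 Nu.
have -> : \sum_(N <= n < K) om (n%:R / 2) / n%:R =
   \sum_(i < m) \sum_(j < m | (i < j)%N) \sum_(N <= n < K) W i j (2 / n%:R) / n%:R.
  under eq_bigr do rewrite /om mulr_suml.
  rewrite exchange_big/=; apply: eq_bigr => i _.
  under eq_bigr do rewrite mulr_suml.
  rewrite exchange_big/=; apply: eq_bigr => j _.
  by apply: eq_bigr => n _; rewrite invf_div.
apply: ler_sum => i _; apply: ler_sum => j ij.
apply: (@sum_le_integral _ _ u0) => //.
- move=> s s0u; have /andP[s0 _] := s0u; split; first exact: omega_ge0.
  exact: omega_finE.
- by move=> s s'; exact: le_omega.
- rewrite -/(I i j) fineK// ge0_fin_numE ?hD//.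
  apply: integral_ge0 => s; rewrite /= in_itv/= => /andP[s0 _].
  by rewrite mule_ge0 ?omega_ge0// lee_fin invr_ge0 ltW.
Qed.

(** The power bound is known only near the corner. Between [dl] and u0 the modulus is at most [B],
    and s^eta >= dl^eta makes B at most (B / dl^eta) s^eta, so a single power bound holds on the
    whole interval. *)
Lemma power_modulus_D : (exists2 eta : R, 0 < eta & forall i j : 'I_m, (i < j)%N ->
     forall p : R * R, pair_density c i j p - lam i j
       =O_(p \near within [set p | 0 < p.1 < 1 /\ 0 < p.2 < 1]
             (nbhs (0 : R, 0 : R)))
         ((p.1 + p.2) `^ eta)) -> D.
Proof.
move=> [eta eta0 hO] i j ij; have nij := ltn_neq ij.
have /andP[u00 u01] := u0_itv.
have /bigO_exP[k k0 /nbhs_ballP[del /= del0 hdel]] := eq_some_OP (funext (hO i j ij)).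
pose B := Mx + `|lam i j|.
have B0 : 0 <= B by rewrite addr_ge0.
(* Half of both radii keeps the corner of side [dl] inside the ball and inside the open unit
   square. *)
pose dl := Num.min del 1 / 2.
have dl0 : 0 < dl by rewrite divr_gt0// lt_min del0/=.
have dl1 : dl < del /\ dl < 1.
  by rewrite /dl; case: (leP del 1); lra.
have small s : 0 < s <= dl -> (omega (pair_density c i j) (lam i j) s <=
    (k * (2 * s) `^ eta)%:E)%E.
  move=> /andP[s0 sd]; apply/ess_sup_on_le; apply: nearW => p [/andP[p10 p1s] /andP[p20 p2s]].
  have hp := hdel p; apply: (@le_trans _ _ (k * `|(p.1 + p.2) `^ eta|)).
    apply: hp; last by split; apply/andP; split => //; lra.
    by split; rewrite /ball/= sub0r normrN gtr0_norm//; lra.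
  rewrite ger0_norm ?powR_ge0// ler_wpM2l ?(ltW k0)//.
  by rewrite ge0_ler_powR ?nnegrE ?(ltW eta0)//; lra.
apply: (@power_modulus_integral_lt_pinfty _ _ u0 eta (k * 2 `^ eta + B / dl `^ eta)) => //.
  by rewrite addr_ge0// ?mulr_ge0 ?powR_ge0 ?(ltW k0)// invr_ge0 powR_ge0.
move=> s /andP[s0 su]; split; first exact: omega_ge0.
have [sd|ds] := leP s dl.
  apply: (le_trans (small s _)); first by rewrite s0.
  rewrite lee_fin powRM// ?(ltW s0)// mulrA ler_wpM2r ?powR_ge0// lerDl.
  by rewrite mulr_ge0// invr_ge0 powR_ge0.
apply: (le_trans (omega_le nij (c_density (card_pair nij)) (lam i j) u0_itv
  (c_boundedM (card_pair nij)) (ltW su))).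
rewrite lee_fin -/B; apply: (@le_trans _ _ (B / dl `^ eta * s `^ eta)).
  rewrite mulrAC ler_pdivlMr ?powR_gt0//; apply: ler_wpM2l => //.
  by rewrite ge0_ler_powR ?nnegrE ?(ltW eta0)//; lra.
by rewrite ler_wpM2r ?powR_ge0// lerDr mulr_ge0 ?powR_ge0// ltW.
Qed.

Let a : R := 2 / pi.
Let tailY (t : R) := fine (P [set x | t < sum_reciprocals x]).
Let tailH (t : R) := fine (P [set x | t < \sum_(i < m) w i * cot (pi * U i x / 2)]).

Lemma tail_cot_sandwich (t : R) : tailY ((t + pi / 2) / a) <= tailH t <= tailY (t / a).
Proof.
have pi0 := pi_gt0 R.
have a0 : 0 < a by rewrite divr_gt0.
have mH : measurable_fun setT (fun x => \sum_(i < m) w i * cot (pi * U i x / 2)).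
  apply: measurable_sum => i; apply: measurable_funM => //.
  apply: (measurableT_comp (@measurable_cot R)); apply: measurable_funM => //.
  by apply: measurable_funM => //; exact: (measurable_funP (U i)).
(* At x = pi U_i / 2 the loss x in the lower bound for cot is at most pi / 2; as the weights sum to
   1, the weighted sum also loses at most pi / 2. *)
have bounds : \forall x \ae P,
   a * sum_reciprocals x - pi / 2 <= \sum_(i < m) w i * cot (pi * U i x / 2)
     <= a * sum_reciprocals x.
  apply: filterS u_ae => x hx.
  have hi i : (a * (U i x)^-1 - pi / 2 <= cot (pi * U i x / 2) <= a * (U i x)^-1).
    have /andP[u1 u2] := hx i.
    have xi : 0 < pi * U i x / 2 < pi / 2.
      have : pi * U i x < pi by rewrite gtr_pMr.
      by have := mulr_gt0 pi0 u1; lra.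
    have /andP[h1 h2] := cot_bounds xi.
    have e : (pi * U i x / 2)^-1 = a * (U i x)^-1.
      by rewrite invf_div invfM mulrA.
    rewrite e in h1 h2; case/andP: xi => x1 x2.
    by apply/andP; split => //; apply: le_trans h1; lra.
  rewrite /sum_reciprocals mulr_sumr; apply/andP; split.
    rewrite [X in _ - X](_ : _ = \sum_(i < m) w i * (pi / 2)); last first.
      by rewrite -mulr_suml w_sum1 mul1r.
    rewrite -sumrB; apply: ler_sum => i _.
    by rewrite mulrCA -mulrBr ler_wpM2l ?(ltW (w_gt0 _))//; case/andP: (hi i).
  apply: ler_sum => i _.
  by rewrite [leRHS]mulrCA ler_wpM2l ?(ltW (w_gt0 _))//; case/andP: (hi i).
apply/andP; split; apply: fine_le_prob_ae;
  try (exact: measurable_gt mH); try (exact: measurable_gt measurable_sum_reciprocals).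
  apply: filterS bounds => x /= /andP[h1 _]; rewrite ltr_pdivrMr// mulrC => h.
  by apply: lt_le_trans h1; lra.
apply: filterS bounds => x /= /andP[_ h2] h; rewrite ltr_pdivrMr// mulrC.
exact: lt_le_trans h h2.
Qed.

Lemma tailY_little_o (eps : R) : 0 < eps -> \forall t \near +oo,
  `|tailY t - (1 / t + 2 * L * (ln t / t ^+ 2))| <= eps * `|ln t / t ^+ 2|.
Proof.
have [C [t0 [N [C0 N4 Nu h]]]] := sum_reciprocals_tail.
apply: (little_o_of_weighted_sum (err := fun t => tailY t - (1 / t + 2 * L * (ln t / t ^+ 2)))
  C0 _ _ om_cvg0 h) => [|n Nn]; first exact: leq_trans N4.
apply: sumr_ge0 => i _; apply: sumr_ge0 => j _; apply: W_ge0.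
by rewrite invr_gt0 divr_gt0// ltr0n (leq_trans _ Nn)// (leq_trans _ N4).
Qed.

Lemma tailY_big_O : D -> exists C t0 : R, [/\ 0 < C, 1 <= t0 & forall t, t0 <= t ->
  `|tailY t - (1 / t + 2 * L * (ln t / t ^+ 2))| <= C / t ^+ 2].
Proof.
move=> /sum_om_bounded[B hB].
have [C [t0 [N [C0 N4 Nu h]]]] := sum_reciprocals_tail.
exists (C * (1 + `|B|) + 1), (Num.max 1 t0).
split; [|by rewrite le_max lexx|].
  by rewrite ltr_wpDl// mulr_ge0// addr_ge0.
move=> t; rewrite ge_max => /andP[t1 tt0]; apply: (le_trans (h t tt0)).
rewrite mulrAC ler_wpM2r//; first by rewrite invr_ge0 exprn_ge0//; lra.
have Bs := hB N (Num.truncn t) (leq_trans _ N4) Nu.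
have {}Bs := le_trans (Bs isT) (ler_norm _).
apply: (@le_trans _ _ (C * (1 + `|B|))); last by rewrite lerDl.
by rewrite ler_wpM2l// lerD2l.
Qed.

Let tailH_transfer (E : R -> R) (t0 : R) :
  (forall s t, t0 <= s <= t -> E s <= E t) ->
  (forall t, t0 <= t -> `|tailY t - (1 / t + 2 * L * (ln t / t ^+ 2))| <= E t / t ^+ 2) ->
  exists t1 C : R, [/\ 1 <= t1, 0 < C & forall t, t1 <= t ->
    `|tailH t - (a / t + 2 * a ^+ 2 * L * (ln t / t ^+ 2))|
      <= (a ^+ 2 * E ((t + pi / 2) / a) + C) / t ^+ 2].
Proof.
move=> Emon hE; have a0 : 0 < a by rewrite divr_gt0// pi_gt0.
have c0 : 0 <= pi / 2 :> R by rewrite divr_ge0// ltW// pi_gt0.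
have K0 : 0 <= 2 * L by rewrite mulr_ge0// L_ge0.
have [t1 [C [t11 C0 h]]] := tail_transfer a0 c0 K0 (fun t _ => tail_cot_sandwich t) Emon hE.
exists t1, C; split => // t tt1.
by rewrite (_ : 2 * a ^+ 2 * L = a ^+ 2 * (2 * L)); [exact: h|ring].
Qed.

Lemma tailH_little_o (eps : R) : 0 < eps -> \forall t \near +oo,
  `|tailH t - (a / t + 2 * a ^+ 2 * L * (ln t / t ^+ 2))| <= eps * `|ln t / t ^+ 2|.
Proof.
move=> eps0; have a0 : 0 < a by rewrite divr_gt0// pi_gt0.
have a20 : 0 < a ^+ 2 by rewrite exprn_gt0.
have c0 : 0 <= pi / 2 :> R by rewrite divr_ge0// ltW// pi_gt0.
(* The transfer multiplies the error by a^2, so this choice uses up half of eps. *)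
pose e := eps / (2 * a ^+ 2); have e0 : 0 < e by rewrite divr_gt0// mulr_gt0.
have /near_pinftyP[t0 ht0] := tailY_little_o e0.
pose t0' := Num.max 1 t0.
have emon s t : t0' <= s <= t -> e * ln s <= e * ln t.
  rewrite ge_max => /andP[/andP[s1 _] st]; rewrite ler_wpM2l ?(ltW e0)//.
  by rewrite ler_ln ?posrE//; lra.
have ebound t : t0' <= t ->
    `|tailY t - (1 / t + 2 * L * (ln t / t ^+ 2))| <= e * ln t / t ^+ 2.
  rewrite ge_max => /andP[t1 /ht0 h]; apply: (le_trans h).
  by rewrite ger0_norm ?mulrA// divr_ge0 ?ln_ge0// exprn_ge0//; lra.
have [t1 [C [t11 C0 h]]] := tailH_transfer emon ebound.
(* For t >= 1, t + pi / 2 <= t (1 + pi / 2), so the transferred logarithm exceeds ln t by at most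
   [b]. The constants [b] and [C] are then absorbed by the second half of eps ln t. *)
pose b := ln (1 + pi / 2) + `|ln a|.
have [t2 [t21 ht2]] := ln_ge_near ((eps / 2 * b + C) / (eps / 2)).
apply/near_pinftyP; exists (Num.max t1 t2) => t.
rewrite ge_max => /andP[tt1 tt2]; have t10 : 1 <= t by lra.
have t00 : 0 < t by lra.
have lnt : 0 <= ln t by rewrite ln_ge0.
have eps20 : 0 < eps / 2 by rewrite divr_gt0.
have hln : ln ((t + pi / 2) / a) <= ln t + b.
  rewrite ln_div ?posrE//; last by lra.
  have l1 : ln (t + pi / 2) <= ln t + ln (1 + pi / 2).
    rewrite -lnM ?posrE//; last by lra.
    rewrite ler_ln ?posrE//; [nra|lra|].
    by rewrite mulr_gt0//; lra.
  have := ler_norm (- ln a); rewrite normrN /b; lra.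
apply: (le_trans (h t tt1)).
rewrite ger0_norm; last by rewrite divr_ge0// exprn_ge0// ltW.
rewrite [leRHS]mulrA ler_wpM2r ?invr_ge0 ?exprn_ge0 ?(ltW t00)//.
have := ht2 t tt2; rewrite ler_pdivrMr// => h2.
rewrite mulrA (_ : a ^+ 2 * e = eps / 2); last by rewrite /e; field; rewrite gt_eqF.
have := ler_wpM2l (ltW eps20) hln; lra.
Qed.

Lemma tailH_big_O : D -> exists C t0 : R, [/\ 0 < C, 1 <= t0 & forall t, t0 <= t ->
  `|tailH t - (a / t + 2 * a ^+ 2 * L * (ln t / t ^+ 2))| <= C / t ^+ 2].
Proof.
move=> /tailY_big_O[C [t0 [C0 t01 h]]].
have [//|t1 [C' [t11 C'0 h']]] := @tailH_transfer (fun=> C) t0 _ h.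
exists (a ^+ 2 * C + C'), t1; split => //.
by rewrite ltr_wpDl// mulr_ge0 ?sqr_ge0// ltW.
Qed.

End weighted_reciprocals.

Unset Implicit Arguments.

Theorem mainTheorem5 (R : realType) (d : measure_display)
  (T : measurableType d) (P : probability T R) (m : nat)
  (U : 'I_m -> {RV P >-> R}) (w : 'I_m -> R)
  (c : forall I : {set 'I_m}, #|I|.-tuple (measurableTypeR R) -> R)
  (u0 : R) (M : {set 'I_m} -> R) (lam : 'I_m -> 'I_m -> R)
  (U_uniform : forall (i : 'I_m) (A : set R), measurable A ->
     distribution P (U i) A = uniform_prob (@ltr01 R) A)
  (w_gt0 : forall i, 0 < w i) (w_sum1 : \sum_(i < m) w i = 1)
  (c_density : forall I : {set 'I_m}, (2 <= #|I|)%N ->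
     is_marginal_density P U (c I))
  (u0_itv : 0 < u0 < 1)
  (c_bounded : forall I : {set 'I_m}, (2 <= #|I|)%N ->
     (ess_sup_on (lebesgue_tuple R #|I|) (lower_boundary u0) (c I)
      <= (M I)%:E)%E)
  (lam_sup : forall i j : 'I_m, (i < j)%N ->
     ess_sup_on (lebesgue_measure \x lebesgue_measure)%E (corner s)
       (pair_density c i j) @[s --> 0^'+] --> (lam i j)%:E)
  (lam_inf : forall i j : 'I_m, (i < j)%N ->
     ess_inf_on (lebesgue_measure \x lebesgue_measure)%E (corner s)
       (pair_density c i j) @[s --> 0^'+] --> (lam i j)%:E) :
  let L := \sum_(i < m) \sum_(j < m | (i < j)%N) lam i j * w i * w j in
  let Y i x := (U i x)^-1 in
  let H i x := cot (pi * U i x / 2) in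
  let a : R := 2 / pi in
  let tailY (t : R) := fine (P [set x | t < \sum_(i < m) w i * Y i x]) in
  let tailH (t : R) := fine (P [set x | t < \sum_(i < m) w i * H i x]) in
  let D := forall i j : 'I_m, (i < j)%N ->
    (\int[lebesgue_measure]_(s in `]0%R, u0[)
       (omega (pair_density c i j) (lam i j) s * (s^-1)%:E) < +oo)%E in
  [/\ forall t : R, tailY t = 1 / t + 2 * L * (ln t / t ^+ 2)
         +o_(t \near +oo) (ln t / t ^+ 2),
      D ->
       forall t : R, tailY t = 1 / t + 2 * L * (ln t / t ^+ 2)
         +O_(t \near +oo) (t ^- 2),
      (exists2 eta : R, 0 < eta & forall i j : 'I_m, (i < j)%N ->
         forall p : R * R, pair_density c i j p - lam i j
           =O_(p \near within [set p | 0 < p.1 < 1 /\ 0 < p.2 < 1]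
                 (nbhs (0 : R, 0 : R)))
             ((p.1 + p.2) `^ eta)) ->
       D,
      forall t : R, tailH t = a / t + 2 * a ^+ 2 * L * (ln t / t ^+ 2)
         +o_(t \near +oo) (ln t / t ^+ 2)
    & D ->
       forall t : R, tailH t = a / t + 2 * a ^+ 2 * L * (ln t / t ^+ 2)
         +O_(t \near +oo) (t ^- 2)].
Proof.
move=> L Y H a tailY tailH D.
have yO := tailY_big_O U_uniform w_gt0 w_sum1 c_density u0_itv c_bounded lam_inf.
have hO := tailH_big_O U_uniform w_gt0 w_sum1 c_density u0_itv c_bounded lam_inf.
have bigO_of (f g : R -> R) : (exists C t0 : R, [/\ 0 < C, 1 <= t0 &
    forall t, t0 <= t -> `|f t - g t| <= C / t ^+ 2]) ->
    forall t : R, f t = g t +O_(t \near +oo) (t ^- 2).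
  move=> [C [t0 [C0 t01 h]]]; apply: (eqaddO_pinfty C0).
  apply/near_pinftyP; exists t0 => t tt0; rewrite [X in _ * X]ger0_norm; first exact: h.
  by rewrite invr_ge0 exprn_ge0//; lra.
split.
- apply: eqaddo_pinfty => eps.
  exact: tailY_little_o U_uniform w_gt0 w_sum1 c_density u0_itv c_bounded lam_sup lam_inf _.
- by move=> /yO; exact: bigO_of.
- exact: power_modulus_D c_density u0_itv c_bounded.
- apply: eqaddo_pinfty => eps.
  exact: tailH_little_o U_uniform w_gt0 w_sum1 c_density u0_itv c_bounded lam_sup lam_inf _.
- by move=> /hO; exact: bigO_of.
Qed.
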